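(* Let $X=X_1\times\cdots\times X_P\subset\mathbb{R}^p$, $Y=Y_1\times\cdots\times Y_Q\subset\mathbb{R}^q$, $Z\subset\mathbb{R}^r$ and $F:\mathbb{R}^p\times\mathbb{R}^q\times\mathbb{R}^r\to\mathbb{R}$, and let $\{(x^k,y^k,z^k)\}_{k\in\mathbb{N}}$ be a sequence generated by the Proximal Heterogeneous Block Implicit-Explicit Algorithm (described in the context) with $(x^0,y^0,z^0)\in X\times Y\times Z$. Suppose that: (i) $X_i\subset\mathbb{R}^{p_i}$, $Y_j\subset\mathbb{R}^{q_j}$ and $Z\subset\mathbb{R}^r$ are nonempty and closed, where $p_i,q_j,r$ are positive integers with $\sum_{i=1}^Pp_i=p$ and $\sum_{j=1}^Qq_j=q$. (ii) $F$ is differentiable on $X\times Y\times Z$ and $\inf F>-\infty$. Moreover, the partial gradients $\nabla_{x_i}F$ ($i=1,\dots,P$) and $\nabla_{y_j}F$ ($j=1,\dots,Q$) are Lipschitz continuous with moduli $L_{x_i}(u_i,y,z)$ and $L_{y_j}(x,v_j,z)$, respectively, as functions of $x_i\in\mathbb{R}^{p_i}$, respectively $y_j\in\mathbb{R}^{q_j}$, with all other variables fixed; here $u_i\in\mathbb{R}^{p-p_i}$ denotes the sub-blocks of $x$ other than $x_i$ and $v_j\in\mathbb{R}^{q-q_j}$ the sub-blocks of $y$ other than $y_j$. (iii) $\nabla F$ is Lipschitz continuous on bounded domains in $X\times Y\times Z$, and there exist $\lambda_{x_i}^+,\lambda_{y_j}^+>0$ ($i=1,\dots,P$, $j=1,\dots,Q$)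 such that $\sup\{L_{x_i}(u_i^k,y^k,z^k):k\in\mathbb{N}\}\le\lambda_{x_i}^+$ and $\sup\{L_{y_j}(x^{k+1},v_j^k,z^k):k\in\mathbb{N}\}\le\lambda_{y_j}^+$. (iv) The iterates $\{(x^k,y^k,z^k)\}_{k\in\mathbb{N}}$ are bounded. (v) The function $\Psi(x,y,z)=F(x,y,z)+\iota_X(x)+\iota_Y(y)+\iota_Z(z)$ is a KL function. Then: (a) The sequence has finite length, that is, $$\sum_{k=1}^\infty\|(x^{k+1},y^{k+1},z^{k+1})-(x^k,y^k,z^k)\|<\infty.$$ (b) The sequence converges to a point $(x^*,y^*,z^* )$ satisfying $$0\in\nabla F(x^*,y^*,z^* )+\partial\iota_X(x^* )\times\partial\iota_Y(y^* )\times\partial\iota_Z(z^* ).$$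
   Context: For a set $C$, $\iota_C$ is the indicator function: $\iota_C(x)=0$ if $x\in C$, $\iota_C(x)=+\infty$ otherwise. Notation. For $\xi\in X_i$ let $\zeta_i^k(\xi)=(x_1^{k+1},\dots,x_{i-1}^{k+1},\xi,x_{i+1}^k,\dots,x_P^k)$ and $u_i^k=(x_1^{k+1},\dots,x_{i-1}^{k+1},x_{i+1}^k,\dots,x_P^k)$. For $\mu\in Y_j$ let $\phi_j^k(\mu)=(y_1^{k+1},\dots,y_{j-1}^{k+1},\mu,y_{j+1}^k,\dots,y_Q^k)$ and $v_j^k=(y_1^{k+1},\dots,y_{j-1}^{k+1},y_{j+1}^k,\dots,y_Q^k)$. For fixed $\eta_{x_i},\eta_{y_j}>0$ put $L_{x_i}'=\max\{L_{x_i},\eta_{x_i}\}$ and $L_{y_j}'=\max\{L_{y_j},\eta_{y_j}\}$ (with the same arguments). Proximal Heterogeneous Block Implicit-Explicit Algorithm. Choose $\alpha_i>1$ ($i=1,\dots,P$), $\beta_j>1$ ($j=1,\dots,Q$), $\gamma>0$ and $(x^0,y^0,z^0)\in X\times Y\times Z$. For $k=0,1,\dots$: 1. Successively for $i=1,\dots,P$, with $\alpha_i^k=\alpha_iL_{x_i}'(u_i^k,y^k,z^k)$, select $x_i^{k+1}\in\operatorname{argmin}_{x_i\in X_i}\{\langle x_i-x_i^k,\nabla_{x_i}F(\zeta_i^k(x_i^k),y^k,z^k)\rangle+\frac{\alpha_i^k}{2}\|x_i-x_i^k\|^2\}$. 2. Successively for $j=1,\dots,Q$, with $\beta_j^k=\beta_jL_{y_j}'(x^{k+1},v_j^k,z^k)$,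 select $y_j^{k+1}\in\operatorname{argmin}_{y_j\in Y_j}\{\langle y_j-y_j^k,\nabla_{y_j}F(x^{k+1},\phi_j^k(y_j^k),z^k)\rangle+\frac{\beta_j^k}{2}\|y_j-y_j^k\|^2\}$. 3. Select $z^{k+1}\in\operatorname{argmin}_{z\in Z}\{F(x^{k+1},y^{k+1},z)+\frac{\gamma}{2}\|z-z^k\|^2\}$. Subdifferential. For $f:\mathbb{R}^d\to(-\infty,+\infty]$ proper and lower semicontinuous and $u\in\operatorname{dom}f$, the regular (Fréchet) subdifferential $\widehat\partial f(u)$ is the set of $v\in\mathbb{R}^d$ with $\liminf_{w\to u,\,w\ne u}\frac{f(w)-f(u)-\langle v,w-u\rangle}{\|w-u\|}\ge0$, and $\widehat\partial f(u)=\emptyset$ for $u\notin\operatorname{dom}f$. The limiting subdifferential $\partial f(u)$ is the set of $v$ for which there exist $u^k\to u$ with $f(u^k)\to f(u)$ and $v^k\to v$ with $v^k\in\widehat\partial f(u^k)$. $\operatorname{dom}\partial f=\{u:\partial f(u)\neq\emptyset\}$. KL property. For $\eta\in(0,+\infty]$ let $\mathcal{C}_\eta$ be the set of continuous functions $\varphi:[0,\eta)\to\mathbb{R}_+$ with $\varphi(0)=0$, $\varphi$ of class $C^1$ on $(0,\eta)$ and $\varphi'(s)>0$ for all $s\in(0,\eta)$. A proper lower semicontinuous $f$ has the Kurdyka-Łojasiewicz (KL) property at $\bar u\in\operatorname{dom}\partial f$ if there exist $\eta\in(0,+\infty]$, a neighborhood $U$ of $\bar u$ and $\varphi\in\mathcal{C}_\eta$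 such that for all $u\in U$ with $f(\bar u)<f(u)<f(\bar u)+\eta$ one has $\varphi'(f(u)-f(\bar u))\,\operatorname{dist}(0,\partial f(u))\ge1$ (with $\operatorname{dist}(0,\emptyset)=+\infty$). $f$ is a KL function if it has the KL property at each point of $\operatorname{dom}\partial f$. *)

(* Defs.v *)
(* MathComp / MathComp-Analysis, over an arbitrary [R : realType]. *)
From HB Require Import structures.
From mathcomp Require Import all_boot all_order all_algebra.
From mathcomp Require Import all_classical all_reals all_analysis.

Set Implicit Arguments.
Unset Strict Implicit.
Unset Printing Implicit Defensive.

Import Order.TTheory GRing.Theory Num.Theory.
Import numFieldNormedType.Exports.

Local Open Scope classical_set_scope.
Local Open Scope ring_scope.

(* The library norm [`|x|] on ['rV[R]_n] is the maximum norm; it induces the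
   usual topology, bounded sets and differentiability, so the library notions
   are used for those, but every norm that occurs in a formula is [enorm]. *)
Definition dotv (R : realType) (n : nat) (u v : 'rV[R]_n) : R :=
  \sum_(i < n) u ord0 i * v ord0 i.

Definition enorm (R : realType) (n : nat) (u : 'rV[R]_n) : R :=
  Num.sqrt (dotv u u).

(* Meaningful only where [f] is differentiable, which is always required
   separately. *)
Definition grad (R : realType) (n : nat) (f : 'rV[R]_n -> R) (x : 'rV[R]_n) :
  'rV[R]_n := \row_(j < n) 'D_(delta_mx ord0 j) f x.

Definition lipschitz_grad (R : realType) (n : nat) (M : R)
    (f : 'rV[R]_n -> R) : Prop :=
  (forall x, differentiable f x) /\
  (forall x x', enorm (grad f x - grad f x') <= M * enorm (x - x')).

Definition argmin (R : realType) (T : Type) (A : set T) (f : T -> R) : set T :=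
  [set a | A a /\ forall b, A b -> f a <= f b].

Definition ind (R : realType) (T : Type) (C : set T) (x : T) : \bar R :=
  (if x \in C then 0 else +oo)%E.

(* R^(p_1) x ... x R^(p_P) is ['rV[R]_(\sum_i p i)]; the i-th block of [x] is
   [submxrow x i]. *)
Definition prod_blocks (R : realType) (P : nat) (p : 'I_P -> nat)
    (Xs : forall i, set 'rV[R]_(p i)) : set 'rV[R]_(\sum_(i < P) p i) :=
  [set x | forall i, Xs i (submxrow x i)].

Definition set_block (R : realType) (P : nat) (p : 'I_P -> nat)
    (x : 'rV[R]_(\sum_(i < P) p i)) (i : 'I_P) (xi : 'rV[R]_(p i)) :
  'rV[R]_(\sum_(i < P) p i) :=
  \mxrow_(l < P) dfwith (fun l' => submxrow x l') i xi l.

(* [lift i] enumerates increasingly the indices other than [i]. *)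
Definition other_blocks (R : realType) (P : nat) (p : 'I_P -> nat)
    (x : 'rV[R]_(\sum_(i < P) p i)) (i : 'I_P) :
  'rV[R]_(\sum_(l < P.-1) p (lift i l)) :=
  \mxrow_(l < P.-1) submxrow x (lift i l).

Definition block_grad (R : realType) (P : nat) (p : 'I_P -> nat)
    (f : 'rV[R]_(\sum_(i < P) p i) -> R) (i : 'I_P)
    (x : 'rV[R]_(\sum_(i < P) p i)) : 'rV[R]_(p i) :=
  grad (fun xi => f (set_block x xi)) (submxrow x i).

(* The state of a sweep over the blocks just before block [i] is updated:
   (x_1^{k+1}, ..., x_{i-1}^{k+1}, x_i^k, ..., x_P^k). *)
Definition sweep (R : realType) (P : nat) (p : 'I_P -> nat)
    (x : nat -> 'rV[R]_(\sum_(i < P) p i)) (k : nat) (i : 'I_P) :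
  'rV[R]_(\sum_(i < P) p i) :=
  \mxrow_(l < P)
    if (l < i)%N then submxrow (x k.+1) l else submxrow (x k) l.

(* zeta_i^k for the x-blocks, phi_j^k for the y-blocks *)
Definition zeta (R : realType) (P : nat) (p : 'I_P -> nat)
    (x : nat -> 'rV[R]_(\sum_(i < P) p i)) (k : nat) (i : 'I_P)
    (xi : 'rV[R]_(p i)) : 'rV[R]_(\sum_(i < P) p i) :=
  set_block (sweep x k i) xi.

(* u_i^k for the x-blocks, v_j^k for the y-blocks *)
Definition others (R : realType) (P : nat) (p : 'I_P -> nat)
    (x : nat -> 'rV[R]_(\sum_(i < P) p i)) (k : nat) (i : 'I_P) :
  'rV[R]_(\sum_(l < P.-1) p (lift i l)) :=
  other_blocks (sweep x k i) i.

Definition join3 (R : realType) (m n r : nat)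
    (x : 'rV[R]_m) (y : 'rV[R]_n) (z : 'rV[R]_r) : 'rV[R]_(m + n + r) :=
  row_mx (row_mx x y) z.

Definition joint (R : realType) (T : Type) (m n r : nat)
    (F : 'rV[R]_m -> 'rV[R]_n -> 'rV[R]_r -> T) (w : 'rV[R]_(m + n + r)) : T :=
  F (lsubmx (lsubmx w)) (rsubmx (lsubmx w)) (rsubmx w).

Definition prod3 (R : realType) (m n r : nat)
    (A : set 'rV[R]_m) (B : set 'rV[R]_n) (C : set 'rV[R]_r) :
  set 'rV[R]_(m + n + r) :=
  [set w | joint (fun x y z => [/\ A x, B y & C z]) w].

(* One linearized proximal step on a block: [a] is the current block, [g] the
   partial gradient, [c] the proximal coefficient. *)
Definition prox_linear (R : realType) (n : nat) (C : set 'rV[R]_n)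
    (a g : 'rV[R]_n) (c : R) : set 'rV[R]_n :=
  argmin C (fun xi => dotv (xi - a) g + c / 2 * enorm (xi - a) ^+ 2).

Definition implicit_explicit_sequence (R : realType) (P Q r : nat)
    (p : 'I_P -> nat) (q : 'I_Q -> nat)
    (Xs : forall i, set 'rV[R]_(p i)) (Ys : forall j, set 'rV[R]_(q j))
    (Z : set 'rV[R]_r)
    (F : 'rV[R]_(\sum_(i < P) p i) -> 'rV[R]_(\sum_(j < Q) q j) ->
         'rV[R]_r -> R)
    (Lx : forall i : 'I_P, 'rV[R]_(\sum_(l < P.-1) p (lift i l)) ->
          'rV[R]_(\sum_(j < Q) q j) -> 'rV[R]_r -> R)
    (Ly : forall j : 'I_Q, 'rV[R]_(\sum_(i < P) p i) ->
          'rV[R]_(\sum_(l < Q.-1) q (lift j l)) -> 'rV[R]_r -> R)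
    (etax alpha : 'I_P -> R) (etay beta : 'I_Q -> R) (gamma : R)
    (x : nat -> 'rV[R]_(\sum_(i < P) p i))
    (y : nat -> 'rV[R]_(\sum_(j < Q) q j))
    (z : nat -> 'rV[R]_r) : Prop :=
  [/\ prod_blocks Xs (x 0%N), prod_blocks Ys (y 0%N), Z (z 0%N) &
   forall k,
   [/\ forall i,
         prox_linear (Xs i) (submxrow (x k) i)
           (block_grad (fun x' => F x' (y k) (z k)) i
              (zeta x k (submxrow (x k) i)))
           (alpha i * Num.max (Lx i (others x k i) (y k) (z k)) (etax i))
           (submxrow (x k.+1) i),
       forall j,
         prox_linear (Ys j) (submxrow (y k) j)
           (block_grad (fun y' => F (x k.+1) y' (z k)) j
              (zeta y k (submxrow (y k) j)))
           (beta j * Num.max (Ly j (x k.+1) (others y k j) (z k)) (etay j))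
           (submxrow (y k.+1) j) &
       argmin Z
         (fun z' => F (x k.+1) (y k.+1) z' + gamma / 2 * enorm (z' - z k) ^+ 2)
         (z k.+1)]].

Definition proper (R : realType) (n : nat) (f : 'rV[R]_n -> \bar R) : Prop :=
  ((forall u, -oo < f u) /\ exists u, f u < +oo)%E.

Definition frechet_subdiff (R : realType) (n : nat) (f : 'rV[R]_n -> \bar R)
    (u : 'rV[R]_n) : set 'rV[R]_n :=
  [set v | (f u < +oo)%E /\
    (0 <= limf_einf (fun w => (f w - f u - (dotv v (w - u))%:E) *
                              ((enorm (w - u))^-1)%:E) u^')%E].

Definition limiting_subdiff (R : realType) (n : nat) (f : 'rV[R]_n -> \bar R)
    (u : 'rV[R]_n) : set 'rV[R]_n :=
  [set v | exists uk vk : nat -> 'rV[R]_n,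
    [/\ uk k @[k --> \oo] --> u,
        f (uk k) @[k --> \oo] --> f u,
        vk k @[k --> \oo] --> v &
        forall k, frechet_subdiff f (uk k) (vk k)]].

(* The infimum of the empty set is +oo. *)
Definition dist0 (R : realType) (n : nat) (A : set 'rV[R]_n) : \bar R :=
  ereal_inf [set (enorm v)%:E | v in A].

(* The class C_eta; only the values of [phi] on [0, eta) matter. *)
Definition desingularizing (R : realType) (eta : \bar R) (phi : R -> R) :
  Prop :=
  [/\ {within [set s : R | 0 <= s /\ (s%:E < eta)%E], continuous phi},
      forall s : R, 0 <= s -> (s%:E < eta)%E -> 0 <= phi s,
      phi 0 = 0 &
      forall s : R, 0 < s -> (s%:E < eta)%E ->
        [/\ derivable phi s 1, {for s, continuous (derive1 phi)} &
            0 < derive1 phi s]].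

Definition KL_at (R : realType) (n : nat) (f : 'rV[R]_n -> \bar R)
    (ubar : 'rV[R]_n) : Prop :=
  exists (eta : \bar R) (U : set 'rV[R]_n) (phi : R -> R),
    [/\ (0 < eta)%E, nbhs ubar U, desingularizing eta phi &
        forall u, U u -> (f ubar < f u)%E -> (f u < f ubar + eta)%E ->
          (1 <= (derive1 phi (fine (f u - f ubar)))%:E *
                dist0 (limiting_subdiff f u))%E].

Definition KL_function (R : realType) (n : nat) (f : 'rV[R]_n -> \bar R) :
  Prop :=
  [/\ proper f, lower_semicontinuous f &
      forall u, limiting_subdiff f u !=set0 -> KL_at f u].

(* Main.v *)
(* [phi] is not assumed concave, so [phi (s k) - phi (s k.+1)] cannot be bounded
   below by [derive1 phi (s k) * (s k - s k.+1)], where [s k] is the gap between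
   the objective at the k-th iterate [w k] and at a cluster point. Instead the KL
   inequality is used on all of the slice of values [s k.+1, s k]: minimising
   [phi] of the gap plus quadratic penalties yields a feasible [u] at distance
   O(D) from [w k], D := phi (s k) - phi (s k.+1), whose value is at most that of
   [w k.+1]. Step [k] compares [w k.+1] with every feasible point through a model
   of [F - F (w k)] which is only partially linearised, and the model may differ
   from [F - F (w k)] at [u], since the feasible set is not convex; but this
   difference vanishes at [w k] and its gradient at feasible points near [w k] is
   O(|w k.+1 - w k| + D), so penalising its square as well forces it to be
   O((|w k.+1 - w k| + D) * D) at [u]. The descent inequality
   at [u] then reads a * |w k.+1 - w k|^2 = O((|w k.+1 - w k| + D) * D), whence
   |w k.+1 - w k| = O(D), which telescopes. *)

Require Import Defs.
From HB Require Import structures.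
From mathcomp Require Import all_boot all_order all_algebra.
From mathcomp Require Import all_classical all_reals all_analysis.
From mathcomp Require Import ring lra.

Import Order.TTheory GRing.Theory Num.Theory.
Import numFieldNormedType.Exports.

Local Open Scope classical_set_scope.
Local Open Scope ring_scope.

Set Implicit Arguments.
Unset Strict Implicit.
Unset Printing Implicit Defensive.

(** * Euclidean norm *)

Section EuclideanNorm.
Context {R : realType} {n : nat}.
Implicit Types (u v w : 'rV[R]_n) (a : R).

Lemma dotvC u v : dotv u v = dotv v u.
Proof. by apply: eq_bigr => i _; rewrite mulrC. Qed.

Lemma dotvDr u v w : dotv u (v + w) = dotv u v + dotv u w.
Proof. by rewrite -big_split; apply: eq_bigr => i _; rewrite mxE mulrDr. Qed.

Lemma dotvZr a u v : dotv u (a *: v) = a * dotv u v.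
Proof. by rewrite mulr_sumr; apply: eq_bigr => i _; rewrite mxE mulrCA. Qed.

Lemma dotvNr u v : dotv u (- v) = - dotv u v.
Proof. by rewrite -scaleN1r dotvZr mulN1r. Qed.

Lemma dotvBr u v w : dotv u (v - w) = dotv u v - dotv u w.
Proof. by rewrite dotvDr dotvNr. Qed.

Lemma dotvDl u v w : dotv (v + w) u = dotv v u + dotv w u.
Proof. by rewrite dotvC dotvDr !(dotvC u). Qed.

Lemma dotvZl a u v : dotv (a *: v) u = a * dotv v u.
Proof. by rewrite dotvC dotvZr (dotvC u). Qed.

Lemma dotvNl u v : dotv (- v) u = - dotv v u.
Proof. by rewrite dotvC dotvNr (dotvC u). Qed.

Lemma dotvBl u v w : dotv (v - w) u = dotv v u - dotv w u.
Proof. by rewrite dotvDl dotvNl. Qed.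

Lemma dotv0 u : dotv u 0 = 0.
Proof. by rewrite -(scale0r u) dotvZr mul0r. Qed.

Lemma dot0v u : dotv 0 u = 0.
Proof. by rewrite dotvC dotv0. Qed.

Lemma dotvv_ge0 u : 0 <= dotv u u.
Proof. by apply: sumr_ge0 => i _; rewrite -expr2 sqr_ge0. Qed.

Lemma enorm_ge0 u : 0 <= enorm u.
Proof. exact: sqrtr_ge0. Qed.

Lemma enorm_sqr u : enorm u ^+ 2 = dotv u u.
Proof. by rewrite sqr_sqrtr // dotvv_ge0. Qed.

Lemma enorm0 : enorm (0 : 'rV[R]_n) = 0.
Proof. by rewrite /enorm dotv0 sqrtr0. Qed.

Lemma enormZ a u : enorm (a *: u) = `|a| * enorm u.
Proof.
by rewrite /enorm dotvZl dotvZr mulrA -expr2 sqrtrM ?sqr_ge0 // sqrtr_sqr.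
Qed.

Lemma enormN u : enorm (- u) = enorm u.
Proof. by rewrite -scaleN1r enormZ normrN normr1 mul1r. Qed.

Lemma enormB u v : enorm (u - v) = enorm (v - u).
Proof. by rewrite -enormN opprB. Qed.

Lemma enorm_eq0 u : enorm u = 0 -> u = 0.
Proof.
move=> u0; have : dotv u u = 0 by rewrite -enorm_sqr u0 expr0n.
move/eqP; rewrite psumr_eq0 => [/allP h|i _]; last by rewrite -expr2 sqr_ge0.
apply/rowP => i; rewrite mxE; have /implyP/(_ isT) := h i (mem_index_enum i).
by rewrite mulf_eq0 => /orP[]/eqP.
Qed.

Lemma enormD_sqr u v :
  enorm (u + v) ^+ 2 = enorm u ^+ 2 + 2 * dotv u v + enorm v ^+ 2.
Proof. by rewrite !enorm_sqr dotvDl !dotvDr (dotvC v u); ring. Qed.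

(** Cauchy-Schwarz: the squared norm of |v| u - |u| v is nonnegative and expands to 2 |u| |v| (|u|
    |v| - <u, v>). *)
Lemma dotv_le u v : dotv u v <= enorm u * enorm v.
Proof.
have [u0|u0] := eqVneq (enorm u) 0.
  by rewrite (enorm_eq0 u0) dot0v enorm0 mul0r.
have up : 0 < enorm u by rewrite lt_neqAle eq_sym u0 enorm_ge0.
have := sqr_ge0 (enorm (enorm v *: u - enorm u *: v)).
rewrite enormD_sqr enormN !enormZ dotvNr dotvZl dotvZr.
rewrite !ger0_norm ?enorm_ge0 // => h.
have [v0|v0] := eqVneq (enorm v) 0.
  by rewrite (enorm_eq0 v0) dotv0 enorm0 mulr0.
have vp : 0 < enorm v by rewrite lt_neqAle eq_sym v0 enorm_ge0.
have {}h : 0 <= 2 * (enorm u * enorm v) * (enorm u * enorm v - dotv u v).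
  by apply: le_trans h _; rewrite le_eqVlt; apply/orP; left; apply/eqP; ring.
by rewrite -subr_ge0; move: h; rewrite pmulr_rge0 // !mulr_gt0.
Qed.

Lemma normr_dotv_le u v : `|dotv u v| <= enorm u * enorm v.
Proof.
by rewrite ler_norml dotv_le andbT lerNl -dotvNl -(enormN u) dotv_le.
Qed.

Lemma ler_enormD u v : enorm (u + v) <= enorm u + enorm v.
Proof.
rewrite -(@ler_pXn2r _ 2) ?nnegrE ?enorm_ge0 ?addr_ge0 ?enorm_ge0 //.
by rewrite enormD_sqr sqrrD; have := dotv_le u v; lra.
Qed.

Lemma ler_enorm_dist w u v : enorm (u - v) <= enorm (u - w) + enorm (w - v).
Proof.
by have := ler_enormD (u - w) (w - v); rewrite addrA subrK.
Qed.


(** Each squared coordinate of [u] is dominated by one of [v], at distinct positions because [g] is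
    injective. With [g] the inclusion of the indices of a block, this bounds a block by the whole
    vector. *)
Lemma ler_enorm_coord m u (v : 'rV[R]_m) (g : 'I_n -> 'I_m) :
  injective g -> (forall j, `|u ord0 j| <= `|v ord0 (g j)|) ->
  enorm u <= enorm v.
Proof.
move=> gI uv; rewrite ler_wsqrtr //.
apply: (@le_trans _ _ (\sum_(j in 'I_n) v ord0 (g j) * v ord0 (g j))).
  apply: ler_sum => j _; rewrite -!expr2 -(real_normK (num_real (u _ _))).
  by rewrite -(real_normK (num_real (v _ _))) ler_pXn2r ?nnegrE.
rewrite -(big_imset (fun i => v ord0 i * v ord0 i)) /=; last by move=> ? ? _ _ /gI.
rewrite big_mkcond; apply: ler_sum => i _; case: ifP => // _.
by rewrite -expr2 sqr_ge0.
Qed.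

Lemma normr_le_enorm u : `|u| <= enorm u.
Proof.
rewrite [`|u|]mx_normrE; apply/bigmax_leP; split=> [|[i j] _ /=].
  exact: enorm_ge0.
rewrite (ord1 i) -sqrtr_sqr ler_wsqrtr // expr2 /dotv (bigD1 j) //= lerDl.
by apply: sumr_ge0 => l _; rewrite -expr2 sqr_ge0.
Qed.

Lemma normr_coord_le u j : `|u ord0 j| <= `|u|.
Proof.
rewrite [`|u|]mx_normrE.
exact: (@le_bigmax _ _ _ 0 (fun ij : 'I_1 * 'I_n => `|u ij.1 ij.2|) (ord0, j)).
Qed.

(** The crude factor [n.+1] stays positive when [n = 0], so it can be divided by. *)
Lemma enorm_le_normr u : enorm u <= n.+1%:R * `|u|.
Proof.
rewrite -(@ler_pXn2r _ 2) ?nnegrE ?enorm_ge0 ?mulr_ge0 //.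
rewrite enorm_sqr exprMn; apply: (@le_trans _ _ (\sum_(j < n) `|u| ^+ 2)).
  apply: ler_sum => j _; rewrite -expr2 -(real_normK (num_real (u _ _))).
  by rewrite ler_pXn2r ?nnegrE // normr_coord_le.
rewrite sumr_const card_ord -[X in X <= _]mulr_natl ler_wpM2r ?sqr_ge0 //.
by rewrite -natrX ler_nat (leq_trans (leqnSn n)) // -mulnn leq_pmulr.
Qed.

(** The bridge from the topology of the maximum norm to estimates in [enorm]. *)
Lemma nbhs_enormP u (A : set 'rV[R]_n) :
  nbhs u A <-> exists2 e : R, 0 < e & forall v, enorm (v - u) < e -> A v.
Proof.
split=> [/nbhs_ballP[e /= e0 eA]|[e e0 eA]].
  exists e => // v uv; apply: eA; rewrite mx_norm_ball /ball_ /=.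
  by rewrite distrC (le_lt_trans (normr_le_enorm _)).
apply/nbhs_ballP; exists (e / n.+1%:R); first by rewrite /= divr_gt0.
move=> v; rewrite mx_norm_ball /ball_ /= distrC => uv; apply: eA.
by rewrite (le_lt_trans (enorm_le_normr _)) // mulrC -ltr_pdivlMr.
Qed.

Lemma enorm_continuous w : continuous (fun u => enorm (u - w)).
Proof.
move=> u; apply/(@cvgrPdist_lt R R^o _ (nbhs u)) => e e0.
apply/nbhs_enormP; exists e => // v uv.
rewrite ltr_norml; have := ler_enorm_dist u v w; have := ler_enorm_dist v u w.
by rewrite (enormB u v); lra.
Qed.

Lemma closed_enorm_ball w (r : R) : closed [set u | enorm (u - w) <= r].
Proof.
apply: (@closed_comp _ _ (fun u => enorm (u - w)) [set t : R | t <= r]).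
  by move=> u _; exact: enorm_continuous.
exact: closed_le.
Qed.

Lemma bounded_enorm_ball (C : set 'rV[R]_n) w (r : R) :
  bounded_set (C `&` [set u | enorm (u - w) <= r]).
Proof.
exists (`|w| + r); split=> [|M hM u [_ /= ur]]; first exact: num_real.
apply: le_trans (ltW hM); rewrite -[u](subrK w) addrC (le_trans (ler_normD _ _)) //.
by rewrite lerD2l (le_trans (normr_le_enorm _)).
Qed.

Lemma compact_enorm_ball (C : set 'rV[R]_n) w (r : R) :
  closed C -> compact (C `&` [set u | enorm (u - w) <= r]).
Proof.
move=> clC; apply: bounded_closed_compact; first exact: bounded_enorm_ball.
by apply: closedI => //; exact: closed_enorm_ball.
Qed.

End EuclideanNorm.

(** * First-order expansions and the descent lemma *)

Section Differentiation.
Context {R : realType} {n : nat}.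
Implicit Types (f : 'rV[R]_n -> R) (a u v h : 'rV[R]_n).

Lemma dotv_grad f a h : differentiable f a -> dotv (grad f a) h = 'd f a h.
Proof.
move=> df; rewrite [in RHS](row_sum_delta h) linear_sum; apply: eq_bigr => j _.
by rewrite linearZ mxE deriveE //= [RHS]mulrC.
Qed.


Lemma differentiable_near f a (e : R) : differentiable f a -> 0 < e ->
  \forall u \near a, `|f u - f a - 'd f a (u - a)| <= e * enorm (u - a).
Proof.
move=> [[_ /eqaddoP fE]] e0; have := fE e e0; apply: filterS => u.
rewrite lim_id // /= opprD addrA => /le_trans; apply.
by rewrite ler_pM2l // normr_le_enorm.
Qed.

End Differentiation.

(** [g] maps the line through [a] along [b] affinely to the line through [g a] along [v], so both
    difference quotients are the same function of [t]. Derivability and directional derivatives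
    therefore transfer verbatim. *)
Lemma line_quotient {R : realType} {V W : normedModType R} (f : V -> W)
    (U : normedModType R) (g : U -> V) (a b : U) (v : V) :
  (forall t, g (t *: b + a) = t *: v + g a) ->
  (fun t => t^-1 *: ((f \o g \o shift a) (t *: b) - (f \o g) a)) =
  (fun t => t^-1 *: ((f \o shift (g a)) (t *: v) - f (g a))).
Proof. by move=> gE; apply/funext => t /=; rewrite gE. Qed.

Lemma derive_comp_line {R : realType} {U V W : normedModType R} (f : V -> W)
    (g : U -> V) (a b : U) (v : V) :
  (forall t, g (t *: b + a) = t *: v + g a) ->
  'D_b (f \o g) a = 'D_v f (g a).
Proof. by move=> gE; rewrite /derive (line_quotient f gE). Qed.

Lemma derivable_comp_line {R : realType} {U V W : normedModType R} (f : V -> W)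
    (g : U -> V) (a b : U) (v : V) :
  (forall t, g (t *: b + a) = t *: v + g a) ->
  derivable f (g a) v -> derivable (f \o g) a b.
Proof. by move=> gE; rewrite /derivable (line_quotient f gE). Qed.

(** The mean value theorem on [0, 1] is applied to [G], the excess of [f] along the segment over its
    quadratic upper model, up to a constant. Cauchy-Schwarz and the Lipschitz gradient make its
    derivative nonpositive. *)
Lemma descent {R : realType} {n : nat} (f : 'rV[R]_n -> R) (M : R)
    (a b : 'rV[R]_n) :
  lipschitz_grad M f ->
  f b <= f a + dotv (grad f a) (b - a) + M / 2 * enorm (b - a) ^+ 2.
Proof.
move=> [df lip]; set h := b - a; pose l (t : R) := t *: h + a.
have lE (t s : R) : l (s *: 1 + t) = s *: h + l t.
  by rewrite /l scalerDl addrA -[s *: 1]/(s * 1) mulr1.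
have fl (t : R) : is_derive t 1 (f \o l) (dotv (grad f (l t)) h).
  split; last by rewrite (derive_comp_line f (lE t)) deriveE // dotv_grad.
  by apply: (derivable_comp_line (lE t)); exact: diff_derivable.
pose G : R -> R := fun t =>
  (f \o l) t - t * dotv (grad f a) h - M / 2 * enorm h ^+ 2 * t ^+ 2.
pose dG t := dotv (grad f (l t)) h - dotv (grad f a) h - M * enorm h ^+ 2 * t.
have GdG (t : R) : is_derive t 1 G (dG t).
  rewrite /G /dG; apply: is_derive_eq; rewrite /GRing.scale /=; by field.
have Gc : {within `[0, 1], continuous G}.
  by apply: derivable_within_continuous => s _; case: (GdG s).
have [c c01 GE] := MVT ltr01 (fun s _ => GdG s) Gc.
have : dG c <= 0.
  have c0 : 0 < c by move: c01; rewrite in_itv => /andP[].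
  have := dotv_le (grad f (l c) - grad f a) h; rewrite dotvBl => /le_trans.
  have := lip (l c) a; rewrite /l addrK enormZ gtr0_norm // => lc.
  move=> /(_ _ (ler_wpM2r (enorm_ge0 h) lc)); rewrite /dG; nra.
move: GE; rewrite /G /= subr0 mulr1 /l !scale1r !scale0r add0r subrK.
by move=> <-; rewrite expr1n; nra.
Qed.

(** * Subgradients of a function plus an indicator *)

Section Subdifferential.
Context {R : realType} {n : nat}.
Implicit Types (f : 'rV[R]_n -> R) (C : set 'rV[R]_n) (u v w : 'rV[R]_n).

(** The lower limit in epsilon form, where only points of [C] impose a condition. *)
Lemma frechet_subdiff_ind f C u v : C u ->
  (forall e : R, 0 < e -> \forall w \near u,
     C w -> - (e * enorm (w - u)) <= f w - f u - dotv v (w - u)) ->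
  frechet_subdiff (fun w => (f w)%:E + ind R C w)%E u v.
Proof.
move=> Cu fuv; have indu : ind R C u = 0%E by rewrite /ind mem_set.
split; first by rewrite indu adde0 ltry.
rewrite limf_einfE; apply/lee_addgt0Pr => e e0; rewrite -leeBlDr // sub0e.
(* The lower limit is a supremum, over punctured neighbourhoods, of infima: one neighbourhood on
   which the quotient is at least [- e] suffices. *)
apply: le_trans (ereal_sup_ubound _); last first.
  exists [set w | w != u /\
     (C w -> - (e * enorm (w - u)) <= f w - f u - dotv v (w - u))] => //.
  have := fuv e e0; rewrite /dnbhs /within /=; apply: filterS => w.
  by split.
apply/le_ereal_inf_tmp => _ [w [wu /= hw] <-]; rewrite indu adde0.
have wu0 : 0 < enorm (w - u).
  rewrite lt_neqAle enorm_ge0 andbT eq_sym; apply: contra_neq wu => /enorm_eq0.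
  by move/eqP; rewrite subr_eq0 => /eqP.
(* Outside [C] the quotient is +oo. *)
have [Cw|nCw] := pselect (C w); last first.
  rewrite {1}/ind memNset // addey // [X in (X * _)%E](_ : _ = +oo%E) //.
  by rewrite gt0_mulye ?lte_fin ?invr_gt0 // leey.
rewrite {1}/ind mem_set // adde0 -EFinD -EFinM lee_fin.
by rewrite ler_pdivlMr // mulNr; exact: hw.
Qed.

Lemma frechet_limiting_subdiff (f : 'rV[R]_n -> \bar R) u v :
  frechet_subdiff f u v -> limiting_subdiff f u v.
Proof.
by move=> fuv; exists (fun=> u), (fun=> v); split => //; exact: cvg_cst.
Qed.

Lemma limiting_subdiff_indicator C u v : C u ->
  (forall e : R, 0 < e -> \forall w \near u,
     C w -> dotv v (w - u) <= e * enorm (w - u)) ->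
  limiting_subdiff (ind R C) u v.
Proof.
move=> Cu cuv; apply: frechet_limiting_subdiff.
have -> : ind R C = (fun w => 0%:E + ind R C w)%E.
  by apply/funext => w; rewrite add0e.
apply: (frechet_subdiff_ind (f := fun=> 0)) => // e /cuv; apply: filterS => w.
by rewrite subrr sub0r lerN2.
Qed.

End Subdifferential.

(** Fréchet differentiability in the Euclidean norm, as a relation between point and gradient, so
    that gradients of composite penalties follow from calculus rules instead of a computation of
    [grad]. *)
Definition has_grad (R : realType) (n : nat) (f : 'rV[R]_n -> R)
    (a g : 'rV[R]_n) : Prop :=
  forall e : R, 0 < e ->
    \forall u \near a, `|f u - f a - dotv g (u - a)| <= e * enorm (u - a).

(** * Calculus of gradients at a point *)

Section Gradient.
Context {R : realType} {n : nat}.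
Implicit Types (f F E : 'rV[R]_n -> R) (a g w : 'rV[R]_n).

Lemma diff_has_grad f a g : differentiable f a ->
  (forall h, 'd f a h = dotv g h) -> has_grad f a g.
Proof.
by move=> df dE e e0; have := differentiable_near df e0; apply: filterS => u; rewrite dE.
Qed.

Lemma differentiable_has_grad f a : differentiable f a -> has_grad f a (grad f a).
Proof. by move=> df; apply: diff_has_grad => // h; rewrite dotv_grad. Qed.

Lemma has_gradD f1 f2 a g1 g2 : has_grad f1 a g1 -> has_grad f2 a g2 ->
  has_grad (fun u => f1 u + f2 u) a (g1 + g2).
Proof.
move=> h1 h2 e e0; have e2 : 0 < e / 2 by rewrite divr_gt0.
apply: filterS2 (h1 _ e2) (h2 _ e2) => u; rewrite dotvDl !ler_norml; lra.
Qed.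

Lemma has_grad_phi_comp (phi : R -> R) F (c : R) a :
  differentiable F a -> derivable phi (F a - c) 1 ->
  has_grad (fun u => phi (F u - c)) a (derive1 phi (F a - c) *: grad F a).
Proof.
move=> dF dphi; pose psi := phi \o (fun t => t - c).
have psiE t : t *: (1 : R) + F a - c = t *: (1 : R) + (F a - c) by rewrite addrA.
have dpsi : differentiable psi (F a).
  by apply/derivable1_diffP; exact: derivable_comp_line psiE dphi.
apply: (@diff_has_grad (psi \o F) _ _) => [|h]; first exact: differentiable_comp.
rewrite (diff_comp dF dpsi) dotvZl dotv_grad // [LHS]/= diff1E //.
by rewrite !derive1E (derive_comp_line _ psiE) [LHS]mulrC.
Qed.

Lemma has_grad_lipschitz f a g : has_grad f a g ->
  \forall u \near a, `|f u - f a| <= (enorm g + 1) * enorm (u - a).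
Proof.
move=> /(_ 1 ltr01); apply: filterS => u; have := normr_dotv_le g (u - a).
rewrite !ler_norml; lra.
Qed.

Lemma has_grad_continuous f a g : has_grad f a g -> {for a, continuous f}.
Proof.
move=> df; apply/(@cvgrPdist_lt R R^o _ (nbhs a)) => e e0.
have K0 : 0 < enorm g + 1 by rewrite ltr_wpDl ?enorm_ge0.
have near_a : \forall u \near a, enorm (u - a) < e / (enorm g + 1).
  by apply/nbhs_enormP; exists (e / (enorm g + 1)) => //; rewrite divr_gt0.
apply: filterS2 (has_grad_lipschitz df) near_a => u fu ua.
rewrite distrC (le_lt_trans fu) //; move: ua.
by rewrite ltr_pdivlMr // mulrC.
Qed.

Lemma has_gradN f a g : has_grad f a g -> has_grad (fun u => - f u) a (- g).
Proof.
by move=> df e /df; apply: filterS => u; rewrite dotvNl -!opprD normrN.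
Qed.

Lemma has_gradDcst f (c : R) a g : has_grad f a g -> has_grad (fun u => f u + c) a g.
Proof. by move=> df e /df; apply: filterS => u; rewrite opprD addrACA subrr addr0. Qed.

Lemma has_grad_sqr E (c : R) a g : 0 <= c -> has_grad E a g ->
  has_grad (fun u => c * E u ^+ 2) a ((2 * c * E a) *: g).
Proof.
move=> c0 dE e e0; set K := enorm g + 1.
(* [q] absorbs the coefficients of both error terms, 2 E(a) times the remainder of [E] and (E(u) -
   E(a))^2, so each is controlled up to [e / q]. *)
pose q := c * (2 * `|E a| + K ^+ 2) + 1.
have q0 : 0 < q by rewrite ltr_wpDl // mulr_ge0 // addr_ge0 ?sqr_ge0 // mulr_ge0.
have eq0 : 0 < e / q by rewrite divr_gt0.
have near_a : \forall u \near a, enorm (u - a) < e / q.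
  by apply/nbhs_enormP; exists (e / q).
apply: filterS3 (dE _ eq0) (has_grad_lipschitz dE) near_a => u h1 h2 h3.
rewrite -/K in h2; set r := e / q in eq0 h1 h3.
have -> : e = r * q by rewrite /r mulrVK // unitfE lt0r_neq0.
have -> : c * E u ^+ 2 - c * E a ^+ 2 - dotv ((2 * c * E a) *: g) (u - a) =
    c * (2 * E a * (E u - E a - dotv g (u - a)) + (E u - E a) ^+ 2).
  by rewrite dotvZl; ring.
have h4 : `|2 * E a * (E u - E a - dotv g (u - a))| <=
    2 * `|E a| * (r * enorm (u - a)).
  by rewrite !normrM normr_nat ler_wpM2l // mulr_ge0.
have h5 : `|(E u - E a) ^+ 2| <= K ^+ 2 * r * enorm (u - a).
  rewrite normrX; apply: (@le_trans _ _ ((K * enorm (u - a)) ^+ 2)).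
    by rewrite ler_pXn2r ?nnegrE // mulr_ge0 ?enorm_ge0 ?addr_ge0 ?enorm_ge0.
  rewrite exprMn -mulrA ler_wpM2l ?sqr_ge0 // expr2.
  by rewrite ler_wpM2r ?enorm_ge0 // ltW.
rewrite normrM ger0_norm //; apply: (@le_trans _ _
  (c * (2 * `|E a| * (r * enorm (u - a)) + K ^+ 2 * r * enorm (u - a)))).
  by rewrite ler_wpM2l // (le_trans (ler_normD _ _)) // lerD.
have := enorm_ge0 (u - a); rewrite /q => ua0.
have : 0 <= r * enorm (u - a) by rewrite mulr_ge0 // ltW.
by lra.
Qed.

Lemma has_grad_enorm_sqr w (c : R) a : 0 <= c ->
  has_grad (fun u => c * enorm (u - w) ^+ 2) a ((2 * c) *: (a - w)).
Proof.
move=> c0 e e0; apply/nbhs_enormP; exists (e / (c + 1)) => [|u ua].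
  by rewrite divr_gt0 // ltr_wpDl.
have -> : u - w = (a - w) + (u - a) by rewrite [RHS]addrC addrA subrK.
rewrite enormD_sqr dotvZl ger0_norm; last first.
  by have := sqr_ge0 (enorm (u - a)); nra.
have := enorm_ge0 (u - a); move: ua; rewrite ltr_pdivlMr ?ltr_wpDl //; nra.
Qed.

(** Fermat's rule for a function [H] with first-order part k F + <g, .>: local minimality over [C]
    bounds k (F u - F a) + <g, u - a> below by a small multiple of |u - a|, and division by [k]
    leaves a Fréchet subgradient of [F] plus the indicator of [C]. *)
Lemma min_frechet (C : set 'rV[R]_n) F H a g gF (k : R) : 0 < k ->
  has_grad F a gF -> has_grad H a (k *: gF + g) ->
  (\forall u \near a, C u -> H a <= H u) ->
  forall e : R, 0 < e -> \forall u \near a,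
    C u -> - (e * enorm (u - a)) <= F u - F a - dotv (- (k^-1 *: g)) (u - a).
Proof.
move=> k0 dF dH Hmin e e0; have e1 : 0 < e / 2 by rewrite divr_gt0.
have e2 : 0 < k * (e / 2) by rewrite mulr_gt0.
apply: filterS3 (dF _ e1) (dH _ e2) Hmin => u hF hH hm Cu.
have {hm}hm := hm Cu; move: hF hH; rewrite !ler_norml => /andP[hF _] /andP[_ hH].
have gE : dotv (- (k^-1 *: g)) (u - a) = - (dotv g (u - a) / k).
  by rewrite dotvNl dotvZl mulrC.
rewrite gE opprK -(ler_pM2l k0).
have {gE} -> : k * (F u - F a + dotv g (u - a) / k) =
    k * (F u - F a) + dotv g (u - a) by field; exact: lt0r_neq0.
move: hH; rewrite dotvDl dotvZl; nra.
Qed.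

End Gradient.

(** * Desingularizing functions and the KL inequality *)

Lemma ereal_lt_between {R : realType} (a : R) (eta : \bar R) :
  (a%:E < eta)%E -> exists2 b : R, a < b & (b%:E < eta)%E.
Proof.
case: eta => [c||] //; last by exists (a + 1); rewrite ?ltry // ltrDl.
by rewrite lte_fin => ac; exists ((a + c) / 2); rewrite ?lte_fin; lra.
Qed.

Lemma desingularizing_lt {R : realType} (eta : \bar R) (phi : R -> R) (s t : R) :
  desingularizing eta phi ->
  0 < s -> s < t -> (t%:E < eta)%E -> phi s < phi t.
Proof.
move=> [_ _ _ dphi] s0 st te.
have dst x : x \in `[s, t] ->
    [/\ derivable phi x 1, {for x, continuous (derive1 phi)} & 0 < derive1 phi x].
  rewrite in_itv => /andP[sx xt]; apply: dphi; first exact: lt_le_trans sx.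
  by apply: le_lt_trans te; rewrite lee_fin.
apply: (@gtr0_derive1_incr _ phi s t) => //.
- by move=> x /subset_itv_oo_cc xi; have [dx _ _] := dst x xi.
- by move=> x /subset_itv_oo_cc xi; have [_ _ dx] := dst x xi.
- by apply: derivable_within_continuous => x xi; have [dx _ _] := dst x xi.
Qed.

(** A Fréchet subgradient is a limiting one, so its norm bounds [dist0] from above; as the
    derivative of [phi] is positive, the KL inequality passes to this norm. *)
Lemma KL_frechet {R : realType} {n : nat} (C : set 'rV[R]_n) (F : 'rV[R]_n -> R)
    (ws u v : 'rV[R]_n) (eta : \bar R) (U : set 'rV[R]_n) (phi : R -> R) :
  let Psi w := ((F w)%:E + ind R C w)%E in
  C ws -> desingularizing eta phi ->
  (forall u, U u -> (Psi ws < Psi u)%E -> (Psi u < Psi ws + eta)%E ->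
     (1 <= (derive1 phi (fine (Psi u - Psi ws)))%:E *
           dist0 (limiting_subdiff Psi u))%E) ->
  U u -> C u -> F ws < F u -> ((F u - F ws)%:E < eta)%E ->
  frechet_subdiff Psi u v -> 1 <= derive1 phi (F u - F ws) * enorm v.
Proof.
move=> Psi Cws [_ _ _ dphi] KL Uu Cu Fu Fe /frechet_limiting_subdiff vu.
have PsiE w : C w -> Psi w = (F w)%:E.
  by move=> Cw; rewrite /Psi /ind mem_set // adde0.
have := KL _ Uu; rewrite !PsiE // lte_fin => /(_ Fu).
rewrite -EFinB /= -lteBlDl // -EFinB => /(_ Fe) h.
have [||_ _ k0] := dphi (F u - F ws) => //; first by lra.
rewrite -lee_fin; apply: le_trans h _; rewrite EFinM lee_pmul2l //.
by apply: ereal_inf_lbound; exists v.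
Qed.

(** Continuity of [F] is available only at points of [C]: closedness of [C] first places the limit
    point there. *)
Lemma closed_sublevel {R : realType} {n : nat} (C : set 'rV[R]_n)
    (F : 'rV[R]_n -> R) (c : R) :
  closed C -> (forall u, C u -> differentiable F u) ->
  closed (C `&` [set u | F u <= c]).
Proof.
move=> clC dF u clu; have Cu : C u by apply: clC; have [] := closureI clu.
split=> //=; rewrite leNgt; apply/negP => cFu.
have : \forall v \near u, c < F v.
  exact: (cvgr_gt _ (differentiable_continuous (dF _ Cu)) _ cFu).
by move=> /clu[v [[_ /=]]]; rewrite leNgt => /negP.
Qed.

(** * The Kurdyka-Lojasiewicz inequality without concavity *)

(* The penalties keep the minimiser close to [w] and [E] small there; their
   gradients are too small for [KL] to hold, so the minimiser has reached the
   level [s]. *)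
Lemma KL_step {R : realType} {n : nat} (C : set 'rV[R]_n) (F E : 'rV[R]_n -> R)
    (gE : 'rV[R]_n -> 'rV[R]_n) (ws w : 'rV[R]_n) (eta : \bar R)
    (U : set 'rV[R]_n) (phi : R -> R) (eps s : R) :
  let D := phi (F w - F ws) - phi (s - F ws) in
  closed C -> (forall u, C u -> differentiable F u) ->
  desingularizing eta phi ->
  (forall u v, U u -> C u -> F ws < F u -> ((F u - F ws)%:E < eta)%E ->
     frechet_subdiff (fun w => (F w)%:E + ind R C w)%E u v ->
     1 <= derive1 phi (F u - F ws) * enorm v) ->
  C w -> F ws < s -> s < F w -> ((F w - F ws)%:E < eta)%E ->
  (forall u, enorm (u - w) <= 5 * D -> U u) ->
  0 < eps -> E w = 0 -> (forall u, C u -> has_grad E u (gE u)) ->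
  (forall u, C u -> enorm (u - w) <= 5 * D -> enorm (gE u) <= eps) ->
  exists u, [/\ C u, F u <= s, enorm (u - w) <= 4 * D & E u <= 8 * eps * D].
Proof.
move=> D clC dF phi_des KL Cw ss sw we Uw eps0 Ew dE Elip.
have [_ _ _ dphi] := phi_des.
have D0 : 0 < D.
  by rewrite subr_gt0; apply: (desingularizing_lt phi_des) => //; lra.
(* Weights chosen so that penalties of total at most [D] force |u - w| <= 4 D and |E u| <= 8 eps D;
   their gradients then have norm at most 1/2 and 1/4. *)
pose c1 := (16 * D)^-1; pose c2 := (64 * eps ^+ 2 * D)^-1.
have c1D : c1 * (16 * D) = 1 by rewrite mulVf // lt0r_neq0 ?mulr_gt0.
have c2D : c2 * (64 * eps ^+ 2 * D) = 1.
  by rewrite mulVf // lt0r_neq0 // !mulr_gt0 // exprn_gt0.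
have c10 : 0 < c1 by rewrite invr_gt0 mulr_gt0.
have c20 : 0 < c2 by rewrite invr_gt0 !mulr_gt0 // exprn_gt0.
(* Flooring the value at [s] keeps the argument of [phi] positive, and lets the [phi] term drop by
   at most [D] below [J w]. *)
pose J u := phi (Num.max (F u) s - F ws) +
  (c1 * enorm (u - w) ^+ 2 + c2 * E u ^+ 2).
(* Compactness gives a minimiser. The radius 5 D exceeds the bound 4 D proved below, so the ball
   constraint is not active at the minimiser. *)
pose K := (C `&` [set u | F u <= F w]) `&` [set u | enorm (u - w) <= 5 * D].
have Kw : K w by split=> //=; rewrite subrr enorm0; nra.
have cK : compact K by apply: compact_enorm_ball; exact: closed_sublevel.
have phi_cont u : K u -> derivable phi (Num.max (F u) s - F ws) 1.
  move=> [[_ /= Fu] _]; have [] // := dphi (Num.max (F u) s - F ws).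
    by rewrite subr_gt0 lt_max ss orbT.
  by apply: le_lt_trans we; rewrite lee_fin lerD2r ge_max Fu ltW.
have cJ : {within K, continuous J}.
  apply: continuous_in_subspaceT => u /set_mem Ku.
  have Cu : C u by case: Ku => -[].
  have cF := differentiable_continuous (dF u Cu).
  have cE := has_grad_continuous (dE u Cu).
  have cphi : {for (Num.max (F u) s - F ws), continuous phi}.
    by apply: differentiable_continuous; apply/derivable1_diffP; exact: phi_cont.
  pose f v := Num.max (F v) s - F ws.
  have cst_cont (c : R) : {for u, continuous (fun=> c)} by exact: cst_continuous.
  have cf : {for u, continuous f}.
    exact: (continuousB (continuous_max cF (cst_cont s)) (cst_cont (F ws))).
  have cphif : {for u, continuous (phi \o f)} by exact: continuous_comp cf cphi.
  have cn : {for u, continuous (fun v : 'rV[R]_n => enorm (v - w))}.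
    exact: enorm_continuous.
  exact: (continuousD cphif (continuousD (continuousM (cst_cont c1)
    (continuousM cn cn)) (continuousM (cst_cont c2) (continuousM cE cE)))).
have [u /set_mem Ku Jmin] := EVT_min_rV (ex_intro _ w Kw) cK cJ.
have {}Jmin v : K v -> J u <= J v by move=> Kv; apply: Jmin; exact: mem_set.
have Jw : J w = phi (F w - F ws).
  by rewrite /J subrr enorm0 Ew !expr0n /= !mulr0 !addr0 max_l // ltW.
have phis : phi (s - F ws) <= phi (Num.max (F u) s - F ws).
  have [Fus|sFu] := leP (F u) s; first by [].
  apply/ltW/(desingularizing_lt phi_des); [by lra|by lra|].
  apply: le_lt_trans we; rewrite lee_fin lerD2r; by case: Ku => -[].
(* Comparison with [w], where both penalties vanish. *)
have small : c1 * enorm (u - w) ^+ 2 + c2 * E u ^+ 2 <= D.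
  by have := Jmin w Kw; rewrite Jw /J /D; lra.
have uw : enorm (u - w) <= 4 * D.
  rewrite -(@ler_pXn2r _ 2) ?nnegrE ?enorm_ge0 //; last by nra.
  have c1u : c1 * enorm (u - w) ^+ 2 <= D by have := sqr_ge0 (E u); nra.
  have -> : enorm (u - w) ^+ 2 = 16 * D * (c1 * enorm (u - w) ^+ 2).
    by rewrite mulrA (mulrC _ c1) c1D mul1r.
  by nra.
have Eu : `|E u| <= 8 * eps * D.
  rewrite -(@ler_pXn2r _ 2) ?nnegrE //; last by rewrite !mulr_ge0 // ltW.
  have c2u : c2 * E u ^+ 2 <= D by have := sqr_ge0 (enorm (u - w)); nra.
  rewrite real_normK ?num_real //.
  have -> : E u ^+ 2 = 64 * eps ^+ 2 * D * (c2 * E u ^+ 2).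
    by rewrite mulrA (mulrC _ c2) c2D mul1r.
  apply: (@le_trans _ _ (64 * eps ^+ 2 * D * D)).
    by rewrite ler_wpM2l // !mulr_ge0 ?sqr_ge0 // ltW.
  by rewrite le_eqVlt; apply/orP; left; apply/eqP; ring.
exists u; have [[Cu /= FuFw] _] := Ku.
split=> //; last exact: le_trans (ler_norm _) Eu.
(* Above level [s] the floor is inactive near [u], so Fermat's rule gives the subgradient
   [- (k^-1 *: g)]. The KL inequality then reads 1 <= |g|, while |g| <= 3/4. *)
rewrite leNgt; apply/negP => sFu.
have Fue : ((F u - F ws)%:E < eta)%E.
  by apply: le_lt_trans we; rewrite lee_fin lerD2r.
have [||dphiu _ k0] := dphi (F u - F ws) => //; first by lra.
set k := derive1 phi (F u - F ws) in k0.
pose g := (2 * c1) *: (u - w) + (2 * c2 * E u) *: gE u.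
have Uu : U u by apply: Uw; lra.
have wsu : F ws < F u by lra.
suff fu : frechet_subdiff (fun w => (F w)%:E + ind R C w)%E u (- (k^-1 *: g)).
  have := KL _ _ Uu Cu wsu Fue fu.
  rewrite enormN enormZ ger0_norm ?invr_ge0 ?(ltW k0) // -/k mulrA mulfV ?lt0r_neq0 //.
  rewrite mul1r leNgt => /negP; apply; apply: le_lt_trans (ler_enormD _ _) _.
  rewrite !enormZ !normrM normr_nat (gtr0_norm c10) (gtr0_norm c20).
  have gEu : enorm (gE u) <= eps.
    by apply: Elip => //; lra.
  have h1 : 2 * c1 * enorm (u - w) <= 2^-1 by nra.
  have h2 : 2 * c2 * `|E u| * enorm (gE u) <= 4^-1.
    have : c2 * `|E u| * enorm (gE u) <= c2 * (8 * eps * D) * eps.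
      apply: ler_pM gEu; [by rewrite mulr_ge0 // ltW|exact: enorm_ge0|].
      by rewrite ler_pM2l.
    by move: c2D; nra.
  lra.
apply: frechet_subdiff_ind => //.
apply: (min_frechet (H := fun v => phi (F v - F ws) +
   (c1 * enorm (v - w) ^+ 2 + c2 * E v ^+ 2)) k0 (differentiable_has_grad (dF u Cu))).
  apply: has_gradD; first exact: has_grad_phi_comp (dF u Cu) dphiu.
  apply: has_gradD; first by apply: has_grad_enorm_sqr; exact: ltW.
  exact: has_grad_sqr (ltW c20) (dE u Cu).
have [b wb be] := ereal_lt_between we.
have cF := differentiable_continuous (dF u Cu).
have near_s : \forall v \near u, s < F v by exact: (cvgr_gt _ cF _ sFu).
have near_b : \forall v \near u, F v < b + F ws by apply: (cvgr_lt _ cF); lra.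
have near_u : \forall v \near u, enorm (v - u) < D by apply/nbhs_enormP; exists D.
apply: filterS3 near_s near_b near_u => v sv vb vu Cv.
have Ju : J u = phi (F u - F ws) + (c1 * enorm (u - w) ^+ 2 + c2 * E u ^+ 2).
  by rewrite /J max_l // ltW.
(* Minimality extends from [K] to a neighbourhood of [u] in [C]: a point with value at most [F w]
   lies in [K], and one with a larger value has a [phi] term of at least [J w]. The bound [b] keeps
   this value inside the range where [phi] increases. *)
rewrite -Ju; have [FvFw|FwFv] := leP (F v) (F w).
  have := Jmin v; rewrite {2}/J max_l ?(ltW sv) //; apply; split=> //=.
  by have := ler_enorm_dist u v w; lra.
apply: (le_trans (Jmin _ Kw)); rewrite Jw.
have : phi (F w - F ws) <= phi (F v - F ws).
  apply/ltW/(desingularizing_lt phi_des); [by lra|by lra|].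
  by apply: le_lt_trans be; rewrite lee_fin; lra.
have := sqr_ge0 (enorm (v - w)); have := sqr_ge0 (E v); nra.
Qed.

(** * Descent along partially linearised models *)

Lemma desingularizing_small {R : realType} (eta : \bar R) (phi : R -> R) (e : R) :
  desingularizing eta phi -> (0 < eta)%E -> 0 < e ->
  exists2 d : R, 0 < d & forall t, 0 <= t -> t < d -> (t%:E < eta)%E /\ phi t < e.
Proof.
move=> [cphi _ phi0 _] eta0 e0; have [b b0 beta] := ereal_lt_between eta0.
have /subspace_continuousP/(_ 0 (conj (lexx _) eta0)) c0 := cphi.
have phi0e : phi 0 < e by rewrite phi0.
have /nbhs_ballP[d /= d0 dP] :
    nbhs (0 : R) [set t | [set s | 0 <= s /\ (s%:E < eta)%E] t -> phi t < e].
  exact: (cvgr_lt _ c0 _ phi0e).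
exists (Num.min b d) => [|t t0]; first by rewrite lt_min b0.
rewrite lt_min => /andP[tb td].
have teta : (t%:E < eta)%E by apply: lt_trans beta; rewrite lte_fin.
split=> //; apply: dP => //; rewrite /ball /= sub0r normrN ger0_norm //.
Qed.

Lemma bounded_cluster {R : realType} {n : nat} (C : set 'rV[R]_n)
    (w : nat -> 'rV[R]_n) :
  closed C -> (forall k, C (w k)) -> bounded_set (range w) ->
  exists2 ws, C ws & forall e N, 0 < e ->
    exists2 k, (N <= k)%N & enorm (w k - ws) < e.
Proof.
move=> clC Cw [M [Mr wM]].
(* The bounds provided by [bounded_set] are the reals strictly above [M]. *)
have wM1 k : `|w k| <= M + 1 by apply: wM; [rewrite ltrDl|exists k].
have cK : compact (C `&` [set u | enorm (u - 0) <= n.+1%:R * (M + 1)]).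
  exact: compact_enorm_ball.
have [|ws [[Cws _] clws]] := cK (w @ \oo) _.
  exists 0%N => // k _; split; first exact: Cw.
  by rewrite /= subr0 (le_trans (enorm_le_normr _)) // ler_pM2l.
exists ws => // e N e0.
have [||_ [[k /= Nk <-] ke]] := clws [set w k | k in [set k | (N <= k)%N]]
    [set u | enorm (u - ws) < e].
- by exists N => // k /= Nk; exists k.
- by apply/nbhs_enormP; exists e.
- by exists k.
Qed.

(** Shows that the cluster point lies in the domain of the limiting subdifferential, where the KL
    property is assumed. *)
Lemma differentiable_limiting_subdiff {R : realType} {n : nat}
    (C : set 'rV[R]_n) (F : 'rV[R]_n -> R) (u : 'rV[R]_n) :
  C u -> differentiable F u ->
  limiting_subdiff (fun w => (F w)%:E + ind R C w)%E u (grad F u).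
Proof.
move=> Cu dF; apply/frechet_limiting_subdiff/frechet_subdiff_ind => // e e0.
have := differentiable_has_grad dF e0; apply: filterS => v.
by rewrite ler_norml => /andP[].
Qed.

Section ModelDescent.
Context {R : realType} {n : nat}.
Variables (C : set 'rV[R]_n) (F : 'rV[R]_n -> R) (w : nat -> 'rV[R]_n).
(** Abstract form of the algorithm: up to a quadratic term, step [k] is compared with every point of
    [C] through a model [T k] of [F - F (w k)]. *)
Variables (T : nat -> 'rV[R]_n -> R) (gT : nat -> 'rV[R]_n -> 'rV[R]_n) (a A : R).
Let d k := enorm (w k.+1 - w k).
Hypotheses (a0 : 0 < a) (A0 : 0 <= A) (clC : closed C).
Hypothesis dF : forall u, C u -> differentiable F u.
Hypothesis Cw : forall k, C (w k).
Hypothesis Tw : forall k, T k (w k) = 0.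
Hypothesis dT : forall k u, C u -> has_grad (T k) u (gT k u).
Hypothesis TF : forall B, bounded_set B -> B `<=` C -> exists M, forall k u,
  B u -> enorm (gT k u - grad F u) <= M * (d k + enorm (u - w k)).
Hypothesis Tmin : forall k u, C u ->
  F (w k.+1) + a * d k ^+ 2 <= F (w k) + T k u + A * enorm (u - w k) ^+ 2.

Lemma model_decrease k : F (w k.+1) + a * d k ^+ 2 <= F (w k).
Proof. by have := Tmin k (Cw k); rewrite Tw subrr enorm0 expr0n mulr0 !addr0. Qed.

Lemma model_nonincreasing k l : (k <= l)%N -> F (w l) <= F (w k).
Proof.
move=> /subnK <-; elim: (l - k)%N => // m IH; rewrite addSn.
apply: le_trans IH; apply: le_trans (model_decrease _).
by rewrite lerDl mulr_ge0 ?sqr_ge0 // ltW.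
Qed.

Lemma model_stationary k : F (w k) <= F (w k.+1) -> d k = 0.
Proof.
have := model_decrease k; have := enorm_ge0 (w k.+1 - w k); rewrite -/(d k).
rewrite le_eqVlt => /orP[/eqP //|d0].
have : 0 < a * d k ^+ 2 by rewrite mulr_gt0 // exprn_gt0.
by lra.
Qed.

(** [KL_step] at level F(w_{k+1}) yields a point [u] close to [w k] where the model error is small;
    the descent inequality tested at [u] bounds the step by the decrease [D] of [phi]. *)
Lemma model_step (ws : 'rV[R]_n) (eta : \bar R) (U : set 'rV[R]_n)
    (phi : R -> R) (M : R) (k : nat) :
  let D := phi (F (w k) - F ws) - phi (F (w k.+1) - F ws) in
  desingularizing eta phi ->
  (forall u v, U u -> C u -> F ws < F u -> ((F u - F ws)%:E < eta)%E ->
     frechet_subdiff (fun w => (F w)%:E + ind R C w)%E u v ->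
     1 <= derive1 phi (F u - F ws) * enorm v) ->
  F ws < F (w k.+1) -> ((F (w k) - F ws)%:E < eta)%E ->
  0 < M ->
  (forall u, C u -> U u ->
     enorm (gT k u - grad F u) <= M * (d k + enorm (u - w k))) ->
  (forall u, enorm (u - w k) <= 5 * D -> U u) ->
  d k <= (1 + (48 * M + 16 * A) / a) * D.
Proof.
move=> D phi_des KL wsw we M0 TFk DU.
have c0 : 0 <= (48 * M + 16 * A) / a by rewrite divr_ge0 ?addr_ge0 ?mulr_ge0 // ltW.
have [Fw|Fw] := leP (F (w k)) (F (w k.+1)).
  have FE : F (w k) = F (w k.+1).
    by apply/eqP; rewrite eq_le Fw model_nonincreasing.
  by rewrite (model_stationary Fw) /D FE subrr mulr0.
have D0 : 0 < D by rewrite subr_gt0; apply: (desingularizing_lt phi_des) => //; lra.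
have dk0 : 0 <= d k by exact: enorm_ge0.
(* The model error: zero at [w k], with gradient [gT k u - grad F u]. *)
pose E u := T k u + (- F u + F (w k)).
have dE u : C u -> has_grad E u (gT k u - grad F u).
  move=> Cu; apply: has_gradD; first exact: dT.
  by apply: has_gradDcst; apply: has_gradN; apply: differentiable_has_grad; exact: dF.
have eps0 : 0 < M * (d k + 5 * D) by rewrite mulr_gt0 // ltr_wpDl // mulr_gt0.
have Ew : E (w k) = 0 by rewrite /E Tw addNr addr0.
have Eb u : C u -> enorm (u - w k) <= 5 * D ->
    enorm (gT k u - grad F u) <= M * (d k + 5 * D).
  move=> Cu uw; apply: le_trans (TFk _ Cu (DU _ uw)) _.
  by rewrite ler_pM2l // lerD2l.
have [] := KL_step clC dF phi_des KL (Cw k) wsw Fw we DU eps0 Ew dE Eb.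
rewrite -/D => u [Cu Fu uw Eu].
have := Tmin k Cu; have -> : T k u = E u + F u - F (w k) by rewrite /E; ring.
(* The summand 1 of the constant covers d <= D. Otherwise d + 5 D <= 6 d turns the error bound into
   48 M d D, and 16 D^2 <= 16 d D; a factor [d k] then cancels. *)
move=> min_u; have [dD|Dd] := leP (d k) D; first by nra.
have u2 : enorm (u - w k) ^+ 2 <= 16 * (d k * D).
  have : enorm (u - w k) ^+ 2 <= (4 * D) ^+ 2.
    by rewrite ler_pXn2r ?nnegrE ?enorm_ge0 // mulr_ge0 // ltW.
  by nra.
have E2 : E u <= 48 * M * (d k * D).
  have : 8 * M * D * (d k + 5 * D) <= 8 * M * D * (6 * d k).
    by rewrite ler_pM2l ?mulr_gt0 //; lra.
  by nra.
have ad : a * d k <= (48 * M + 16 * A) * D.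
  rewrite -(@ler_pM2r _ (d k)); last by lra.
  have := ler_wpM2l A0 u2; nra.
have -> : (1 + (48 * M + 16 * A) / a) * D = D + (48 * M + 16 * A) * D / a.
  by field; exact: lt0r_neq0.
suff : d k <= (48 * M + 16 * A) * D / a by lra.
by rewrite ler_pdivlMr // mulrC.
Qed.

Lemma model_telescope k m : enorm (w (k + m)%N - w k) <= \sum_(j < m) d (k + j).
Proof.
elim: m => [|m IH]; first by rewrite addn0 subrr enorm0 big_ord0.
rewrite big_ord_recr /= addnS; apply: le_trans (ler_enorm_dist (w (k + m)%N) _ _) _.
by rewrite addrC lerD.
Qed.

(** Trapping: once an iterate is close enough to [ws] with a small value of [phi], the length of the
    remaining path is too short to leave the neighbourhood where the KL inequality holds. *)
Lemma model_small_tails (ws : 'rV[R]_n) (e : R) :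
  C ws -> (forall e N, 0 < e -> exists2 k, (N <= k)%N & enorm (w k - ws) < e) ->
  KL_at (fun u => (F u)%:E + ind R C u)%E ws -> 0 < e ->
  exists K, forall m,
    \sum_(j < m) d (K + j) <= e /\ enorm (w (K + m)%N - ws) < e.
Proof.
move=> Cws clu [eta [U [phi [eta0 Uws phi_des KL]]]] e0.
have cF := differentiable_continuous (dF Cws).
(* A value below [F ws] would persist by monotonicity, against continuity at the cluster point. *)
have Fws k : F ws <= F (w k).
  rewrite leNgt; apply/negP => Fk.
  have /nbhs_enormP[r r0 rP] : \forall u \near ws, F (w k) < F u.
    exact: (cvgr_gt _ cF _ Fk).
  have [l kl /rP] := clu r k r0.
  by rewrite ltNge model_nonincreasing.
have Flim b : 0 < b -> exists N, forall k, (N <= k)%N -> F (w k) - F ws < b.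
  move=> b0; have Fb : F ws < F ws + b by lra.
  have /nbhs_enormP[r r0 rP] : \forall u \near ws, F u < F ws + b.
    exact: (cvgr_lt _ cF _ Fb).
  have [N _ /rP FN] := clu r 0%N r0.
  by exists N => k /model_nonincreasing; lra.
have KLw := KL_frechet Cws phi_des KL.
(* If the level [F ws] is reached, the values and hence the iterates are constant from then on,
   equal to [ws] in the limit. *)
have [[K FK]|nK] := pselect (exists K, F (w K) <= F ws).
  have d0 k : (K <= k)%N -> d k = 0.
    move=> Kk; apply: model_stationary.
    by rewrite (le_trans (model_nonincreasing Kk)) // (le_trans FK).
  have wK m : w (K + m)%N = w K.
    apply/eqP; rewrite -subr_eq0; apply/eqP/enorm_eq0/eqP.
    rewrite eq_le enorm_ge0 andbT (le_trans (model_telescope K m)) //.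
    by rewrite big1 // => j _; apply: d0; exact: leq_addr.
  exists K => m; split.
    by rewrite big1 ?ltW // => j _; apply: d0; exact: leq_addr.
  have [k Kk] := clu e K e0; rewrite wK.
  by rewrite -(subnKC Kk) wK.
have {nK}Fgt k : F ws < F (w k).
  by rewrite ltNge; apply/negP => Fk; apply: nK; exists k.
have [r r0 rU] : exists2 r : R, 0 < r & forall u, enorm (u - ws) < r -> U u.
  exact/nbhs_enormP.
have [|u [] //|M0 TM] := @TF (C `&` [set u | enorm (u - ws) <= r]).
  exact: bounded_enorm_ball.
pose M := `|M0| + 1; have Mp : 0 < M by rewrite ltr_wpDl.
have {}TM k u : C u -> enorm (u - ws) < r ->
    enorm (gT k u - grad F u) <= M * (d k + enorm (u - w k)).
  move=> Cu ur; apply: (le_trans (TM k u (conj Cu (ltW ur)))).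
  rewrite ler_wpM2r ?addr_ge0 ?enorm_ge0 //.
  by rewrite /M (le_trans (ler_norm _)) // lerDl.
pose c := 1 + (48 * M + 16 * A) / a.
have c1 : 1 <= c.
  by rewrite lerDl divr_ge0 ?addr_ge0 ?mulr_ge0 // ltW.
pose r' := Num.min e r; have r'0 : 0 < r' by rewrite lt_min e0.
have er' : r' <= e by rewrite ge_min lexx.
have rr' : r' <= r by rewrite ge_min lexx orbT.
(* Budget: the start is within r'/4 of [ws] and (c + 5) p K < r'/4, so a tail of length at most c p
   K, and balls of radius 5 p K around its points, stay within r' of [ws]. *)
have b0 : 0 < r' / (4 * (c + 5)) by rewrite divr_gt0 // mulr_gt0 //; lra.
have [t t0 tP] := desingularizing_small phi_des eta0 b0.
have [N NP] := Flim t t0.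
have r'40 : 0 < r' / 4 by rewrite divr_gt0.
have [K NK Kr] := clu (r' / 4) N r'40.
pose p k := phi (F (w k) - F ws).
have Feta k : (N <= k)%N ->
    ((F (w k) - F ws)%:E < eta)%E /\ p k < r' / (4 * (c + 5)).
  by move=> Nk; apply: tP; [rewrite subr_ge0|exact: NP].
have p0 k : (N <= k)%N -> 0 <= p k.
  move=> Nk; have [_ phi_ge0 _ _] := phi_des.
  by apply: phi_ge0; [rewrite subr_ge0|have [] := Feta k Nk].
have pK : (c + 5) * p K < r' / 4.
  have [_] := Feta K NK; rewrite ltr_pdivlMr; last by rewrite mulr_gt0 //; lra.
  by rewrite ltr_pdivlMr //; lra.
have NKm m : (N <= K + m)%N by rewrite (leq_trans NK) ?leq_addr.
have pK0 := p0 K NK.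
(* Induction: the bound on the first [m] steps keeps [w (K + m)] near [ws], as [model_step] requires
   for the next step, whose bound telescopes in [p]. *)
have sum_d m : \sum_(j < m) d (K + j) <= c * (p K - p (K + m)%N).
  elim: m => [|m IH]; first by rewrite big_ord0 addn0 subrr mulr0.
  have pm0 := p0 _ (NKm m); have pm1 := p0 _ (NKm m.+1).
  have wm : enorm (w (K + m)%N - ws) < r' / 4 + c * p K.
    have := ler_enorm_dist (w K) (w (K + m)%N) ws; have := model_telescope K m.
    have : 0 <= c * p (K + m)%N by rewrite mulr_ge0 //; lra.
    lra.
  rewrite big_ord_recr /= addnS.
  have : d (K + m) <= c * (p (K + m)%N - p (K + m).+1).
    apply: (@model_step ws eta [set u | enorm (u - ws) < r] phi M) => //.
    - by move=> u v /rU Uu Cu Fu ue; exact: KLw.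
    - by have [] := Feta _ (NKm m).
    - by move=> u Cu ur; exact: TM.
    - move=> u um /=; have := ler_enorm_dist (w (K + m)%N) u ws.
      rewrite -/(p _) -/(p _) in um.
      (* Since lengths are nonnegative, the induction hypothesis itself gives monotonicity of
         [p]. *)
      have pKm : p (K + m)%N <= p K.
        have : 0 <= \sum_(j < m) d (K + j).
          by apply: sumr_ge0 => j _; exact: enorm_ge0.
        by move=> /le_trans/(_ IH); rewrite pmulr_rge0 ?subr_ge0 //; lra.
      move: pm1; rewrite addnS; lra.
  move: IH; rewrite !mulrBr; lra.
have sum_r m : \sum_(j < m) d (K + j) <= r' / 4.
  apply: le_trans (sum_d m) _.
  have : 0 <= c * p (K + m)%N by rewrite mulr_ge0 ?p0 //; lra.
  by rewrite mulrBr; lra.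
exists K => m; split; first by have := sum_r m; lra.
have := ler_enorm_dist (w K) (w (K + m)%N) ws; have := model_telescope K m.
by have := sum_r m; lra.
Qed.

(** Arbitrarily short tails near the cluster point give convergence; one tail of length at most 1,
    added to the finitely many earlier steps, gives [S]. *)
Lemma model_converges : bounded_set (range w) ->
  KL_function (fun u => (F u)%:E + ind R C u)%E ->
  exists ws, [/\ C ws, w k @[k --> \oo] --> ws &
    exists S, forall N, \sum_(k < N) d k <= S].
Proof.
move=> bw [_ _ KL]; have [ws Cws clu] := bounded_cluster clC Cw bw.
have KLws : KL_at (fun u => (F u)%:E + ind R C u)%E ws.
  apply: KL; exists (grad F ws).
  by apply: differentiable_limiting_subdiff => //; exact: dF.
have tails e : 0 < e -> exists K, forall m,
    \sum_(j < m) d (K + j) <= e /\ enorm (w (K + m)%N - ws) < e.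
  exact: model_small_tails.
exists ws; split => //.
  apply/cvgrPdist_lt => e /tails[K KP]; exists K => // k /= Kk.
  rewrite distrC (le_lt_trans (normr_le_enorm _)) // -(subnKC Kk).
  by have [] := KP (k - K)%N.
have [K KP] := tails 1 ltr01; exists (\sum_(k < K) d k + 1) => N.
apply: (@le_trans _ _ (\sum_(k < K + N) d k)).
  rewrite addnC big_split_ord /= lerDl.
  by apply: sumr_ge0 => j _; exact: enorm_ge0.
by rewrite big_split_ord /= lerD2l; have [] := KP N.
Qed.

End ModelDescent.

(** * Blocks *)

Section Blocks.
Context {R : realType} {P : nat} {p : 'I_P -> nat}.
Implicit Types (x u v : 'rV[R]_(\sum_(i < P) p i)) (i : 'I_P).

(** As a 1 x 1 matrix product, the inner product follows the block formula for a row of blocks times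
    a column of blocks. *)
Lemma dotv_blocks u v :
  dotv u v = \sum_(i < P) dotv (submxrow u i) (submxrow v i).
Proof.
have dotE m (a b : 'rV[R]_m) : dotv a b = (a *m b^T) ord0 ord0.
  by rewrite mxE; apply: eq_bigr => j _; rewrite !mxE.
rewrite dotE -[u in LHS]submxrowK -[v in LHS]submxrowK tr_mxrow mul_mxrow_mxcol.
by rewrite summxE; apply: eq_bigr => i _; rewrite dotE.
Qed.

Lemma enorm_sqr_blocks u :
  enorm u ^+ 2 = \sum_(i < P) enorm (submxrow u i) ^+ 2.
Proof. by rewrite enorm_sqr dotv_blocks; apply: eq_bigr => i _; rewrite enorm_sqr. Qed.

Lemma enorm_le_blocks u : enorm u <= \sum_(i < P) enorm (submxrow u i).
Proof.
have n0 : 0 <= \sum_(i < P) enorm (submxrow u i).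
  by apply: sumr_ge0 => i _; exact: enorm_ge0.
rewrite -(@ler_pXn2r _ 2) ?nnegrE ?enorm_ge0 // enorm_sqr_blocks expr2 mulr_suml.
apply: ler_sum => i _; rewrite expr2 ler_wpM2l ?enorm_ge0 //.
by rewrite (bigD1 i) //= lerDl; apply: sumr_ge0 => l _; exact: enorm_ge0.
Qed.

Lemma Rank_inj i : injective (@tagnat.Rank P p i).
Proof.
move=> j j' jj'; have := congr1 val jj'; move/eqP; rewrite tagnat.eq_Rank eqxx.
by move/eqP/val_inj.
Qed.

Lemma enorm_submxrow u i : enorm (submxrow u i) <= enorm u.
Proof.
by apply: (ler_enorm_coord (@Rank_inj i)) => j; rewrite mxE.
Qed.

Lemma submxrow_set_block x i (a : 'rV[R]_(p i)) : submxrow (set_block x a) i = a.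
Proof. by rewrite mxrowK dfwithin. Qed.

Lemma submxrow_set_block_neq x i l (a : 'rV[R]_(p i)) : i != l ->
  submxrow (set_block x a) l = submxrow x l.
Proof. by move=> il; rewrite mxrowK dfwithout. Qed.

Lemma set_block_id x i : set_block x (submxrow x i) = x.
Proof.
apply/mxrowP => l; have [<-|il] := eqVneq i l; first by rewrite submxrow_set_block.
by rewrite submxrow_set_block_neq.
Qed.

Lemma submxrowZ (t : R) x i : submxrow (t *: x) i = t *: submxrow x i.
Proof. by apply/rowP => j; rewrite !mxE. Qed.

(** Moving one block along a line is moving the whole vector along the embedded direction
    [set_block 0 v], the form [derive_comp_line] takes. *)
Lemma set_block_line x i (t : R) (v : 'rV[R]_(p i)) :
  set_block x (t *: v + submxrow x i) = t *: set_block 0 v + x.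
Proof.
apply/mxrowP => l; rewrite submxrowD submxrowZ.
have [<-|il] := eqVneq i l; first by rewrite !submxrow_set_block.
by rewrite !submxrow_set_block_neq // submxrow0 scaler0 add0r.
Qed.

Lemma dotv_set_block0 u i (v : 'rV[R]_(p i)) :
  dotv u (set_block 0 v) = dotv (submxrow u i) v.
Proof.
rewrite dotv_blocks (bigD1 i) //= submxrow_set_block big1 ?addr0 // => l li.
by rewrite submxrow_set_block_neq 1?eq_sym // submxrow0 dotv0.
Qed.

Variables (xs : nat -> 'rV[R]_(\sum_(i < P) p i)) (k : nat).

Lemma submxrow_sweep i l : submxrow (sweep xs k i) l =
  submxrow (xs (if (l < i)%N then k.+1 else k)) l.
Proof. by rewrite mxrowK; case: ifP. Qed.

Lemma submxrow_sweep_id i : submxrow (sweep xs k i) i = submxrow (xs k) i.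
Proof. by rewrite submxrow_sweep ltnn. Qed.

Lemma zeta_sweep i : zeta xs k (submxrow (xs k) i) = sweep xs k i.
Proof. by rewrite /zeta -submxrow_sweep_id set_block_id. Qed.

Lemma enorm_sweep i : enorm (sweep xs k i - xs k) <= enorm (xs k.+1 - xs k).
Proof.
rewrite -(@ler_pXn2r _ 2) ?nnegrE ?enorm_ge0 // !enorm_sqr_blocks.
apply: ler_sum => l _; rewrite !submxrowB submxrow_sweep.
by case: ifP => _ //; rewrite subrr enorm0 expr0n sqr_ge0.
Qed.

Lemma prod_blocks_sweep (Xs : forall i, set 'rV[R]_(p i)) i :
  (forall l, prod_blocks Xs (xs l)) -> prod_blocks Xs (sweep xs k i).
Proof. by move=> Xxs l; rewrite submxrow_sweep; exact: Xxs. Qed.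

(** For each block, the descent lemma is added to minimality of the proximal step tested at the
    block of [u]. The condition 2 a + L <= c leaves a decrease of [a] times the squared step, c <= 2
    A bounds the cost at [u], and the sum over blocks telescopes. *)
Lemma sweep_decrease (Xs : forall i, set 'rV[R]_(p i)) f
    (L c : 'I_P -> R) (a A : R) u :
  (forall i, lipschitz_grad (L i)
     (fun xi : 'rV[R]_(p i) => f (set_block (sweep xs k i) xi))) ->
  (forall i, prox_linear (Xs i) (submxrow (xs k) i)
     (block_grad f i (zeta xs k (submxrow (xs k) i))) (c i)
     (submxrow (xs k.+1) i)) ->
  (forall i, 2 * a + L i <= c i <= 2 * A) ->
  prod_blocks Xs u ->
  f (xs k.+1) + a * enorm (xs k.+1 - xs k) ^+ 2 <=
  f (xs k) + dotv (\mxrow_i block_grad f i (sweep xs k i)) (u - xs k)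
  + A * enorm (u - xs k) ^+ 2.
Proof.
move=> lipf prox cL Xu.
(* The state after [m] block updates: [s 0] is [xs k], [s P] is [xs k.+1], and [s i] is the sweep
   before block [i]. *)
pose s m : 'rV[R]_(\sum_(i < P) p i) :=
  \mxrow_(l < P) submxrow (xs (if (l < m)%N then k.+1 else k)) l.
have s0 : s 0%N = xs k by apply/mxrowP => l; rewrite mxrowK ltn0.
have sP : s P = xs k.+1.
  by apply/mxrowP => l; rewrite mxrowK ltn_ord.
have sE i : s i = sweep xs k i.
  by apply/mxrowP => l; rewrite mxrowK submxrow_sweep.
have sS i : s i.+1 = set_block (sweep xs k i) (submxrow (xs k.+1) i).
  apply/mxrowP => l; rewrite mxrowK; have [<-|il] := eqVneq i l.
    by rewrite submxrow_set_block ltnSn.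
  rewrite submxrow_set_block_neq // submxrow_sweep ltnS leq_eqVlt val_eqE.
  by rewrite eq_sym (negPf il).
have sid i : set_block (sweep xs k i) (submxrow (xs k) i) = sweep xs k i.
  by rewrite -submxrow_sweep_id set_block_id.
set D := u - xs k; set D' := xs k.+1 - xs k.
have step i : f (s i.+1) - f (s i) <=
    dotv (block_grad f i (sweep xs k i)) (submxrow D i) +
    A * enorm (submxrow D i) ^+ 2 - a * enorm (submxrow D' i) ^+ 2.
  have := descent (submxrow (xs k) i) (submxrow (xs k.+1) i) (lipf i).
  have [_ /(_ _ (Xu i))] := prox i; rewrite zeta_sweep -!submxrowB -/D -/D'.
  rewrite /block_grad submxrow_sweep_id; set g := grad _ _.
  rewrite -sS sid sE !(dotvC _ g).
  have /andP[h1 h2] := cL i.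
  have := sqr_ge0 (enorm (submxrow D i)); have := sqr_ge0 (enorm (submxrow D' i)).
  nra.
have : f (s P) - f (s 0%N) <= \sum_(i < P)
    (dotv (block_grad f i (sweep xs k i)) (submxrow D i) +
    A * enorm (submxrow D i) ^+ 2 - a * enorm (submxrow D' i) ^+ 2).
  have := @telescope_sumr _ 0 P (f \o s) (leq0n _); rewrite big_mkord /= => <-.
  by apply: ler_sum => i _; exact: step.
rewrite sumrB big_split /= -!mulr_sumr -!enorm_sqr_blocks s0 sP.
have -> : dotv (\mxrow_i block_grad f i (sweep xs k i)) D =
    \sum_(i < P) dotv (block_grad f i (sweep xs k i)) (submxrow D i).
  by rewrite dotv_blocks; apply: eq_bigr => i _; rewrite mxrowK.
lra.
Qed.

End Blocks.

(** * Triples as single row vectors *)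

Section Join3.
Context {R : realType} {m n r : nat}.
Implicit Types (a : 'rV[R]_m) (b : 'rV[R]_n) (c : 'rV[R]_r).
Implicit Types (u v : 'rV[R]_(m + n + r)).

Lemma join3K u : join3 (lsubmx (lsubmx u)) (rsubmx (lsubmx u)) (rsubmx u) = u.
Proof. by rewrite /join3 !hsubmxK. Qed.

Lemma join3_x a b c : lsubmx (lsubmx (join3 a b c)) = a.
Proof. by rewrite /join3 !row_mxKl. Qed.

Lemma join3_y a b c : rsubmx (lsubmx (join3 a b c)) = b.
Proof. by rewrite /join3 row_mxKl row_mxKr. Qed.

Lemma join3_z a b c : rsubmx (join3 a b c) = c.
Proof. by rewrite /join3 row_mxKr. Qed.

Lemma joint_join3 (T : Type) (F : 'rV[R]_m -> 'rV[R]_n -> 'rV[R]_r -> T) a b c :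
  joint F (join3 a b c) = F a b c.
Proof. by rewrite /joint join3_x join3_y join3_z. Qed.

Lemma join3B a b c a' b' c' :
  join3 a b c - join3 a' b' c' = join3 (a - a') (b - b') (c - c').
Proof. by rewrite /join3 !opp_row_mx !add_row_mx. Qed.

Lemma join3_line (t : R) a b c a' b' c' :
  t *: join3 a b c + join3 a' b' c' = join3 (t *: a + a') (t *: b + b') (t *: c + c').
Proof. by rewrite /join3 !scale_row_mx !add_row_mx. Qed.

Lemma dotv_row_mx k l (a a' : 'rV[R]_k) (b b' : 'rV[R]_l) :
  dotv (row_mx a b) (row_mx a' b') = dotv a a' + dotv b b'.
Proof.
rewrite /dotv big_split_ord /=; congr (_ + _); apply: eq_bigr => i _.
  by rewrite !row_mxEl.
by rewrite !row_mxEr.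
Qed.

Lemma dotv_join3 a b c a' b' c' :
  dotv (join3 a b c) (join3 a' b' c') = dotv a a' + dotv b b' + dotv c c'.
Proof. by rewrite !dotv_row_mx. Qed.

Lemma dotv_join3r u a b c : dotv u (join3 a b c) =
  dotv (lsubmx (lsubmx u)) a + dotv (rsubmx (lsubmx u)) b + dotv (rsubmx u) c.
Proof. by rewrite -[u in LHS]join3K dotv_join3. Qed.

Lemma enorm_join3_sqr a b c :
  enorm (join3 a b c) ^+ 2 = enorm a ^+ 2 + enorm b ^+ 2 + enorm c ^+ 2.
Proof. by rewrite !enorm_sqr dotv_join3. Qed.

Lemma enorm_join3_le a b c : enorm (join3 a b c) <= enorm a + enorm b + enorm c.
Proof.
have := enorm_ge0 a; have := enorm_ge0 b; have := enorm_ge0 c => c0 b0 a0.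
rewrite -(@ler_pXn2r _ 2) ?nnegrE ?enorm_ge0 ?addr_ge0 // enorm_join3_sqr.
have := mulr_ge0 a0 b0; have := mulr_ge0 a0 c0; have := mulr_ge0 b0 c0.
by rewrite !expr2; lra.
Qed.

Lemma enorm_join3_mono a b c a' b' c' :
  enorm a <= enorm a' -> enorm b <= enorm b' -> enorm c <= enorm c' ->
  enorm (join3 a b c) <= enorm (join3 a' b' c').
Proof.
move=> aa bb cc; rewrite -(@ler_pXn2r _ 2) ?nnegrE ?enorm_ge0 // !enorm_join3_sqr.
by rewrite !lerD // ler_pXn2r ?nnegrE ?enorm_ge0.
Qed.

Lemma enorm_join3_x u : enorm (lsubmx (lsubmx u)) <= enorm u.
Proof.
rewrite -[u in leRHS]join3K -(@ler_pXn2r _ 2) ?nnegrE ?enorm_ge0 // enorm_join3_sqr.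
by rewrite -addrA lerDl addr_ge0 ?sqr_ge0.
Qed.

Lemma enorm_join3_y u : enorm (rsubmx (lsubmx u)) <= enorm u.
Proof.
rewrite -[u in leRHS]join3K -(@ler_pXn2r _ 2) ?nnegrE ?enorm_ge0 // enorm_join3_sqr.
by rewrite addrAC lerDr addr_ge0 ?sqr_ge0.
Qed.

Lemma enorm_join3_z u : enorm (rsubmx u) <= enorm u.
Proof.
rewrite -[u in leRHS]join3K -(@ler_pXn2r _ 2) ?nnegrE ?enorm_ge0 // enorm_join3_sqr.
by rewrite lerDr addr_ge0 ?sqr_ge0.
Qed.

End Join3.

(** * The algorithm *)

Lemma dotv_ext {R : realType} {n : nat} (u v : 'rV[R]_n) :
  (forall h, dotv u h = dotv v h) -> u = v.
Proof.
move=> uv; apply/eqP; rewrite -subr_eq0; apply/eqP/enorm_eq0/eqP.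
by rewrite -sqrf_eq0 enorm_sqr dotvBl uv subrr.
Qed.

(** The reciprocal of 1 plus the sum of inverses also serves for an empty index type. *)
Lemma finite_lower_bound {R : realType} {I : finType} (f : I -> R) :
  (forall i, 0 < f i) -> exists2 a : R, 0 < a & forall i, a <= f i.
Proof.
move=> f0; have s0 : 0 <= \sum_i (f i)^-1.
  by apply: sumr_ge0 => i _; rewrite invr_ge0 ltW.
exists (1 + \sum_i (f i)^-1)^-1 => [|i]; first by rewrite invr_gt0 ltr_wpDr.
rewrite -[leRHS]invrK lef_pV2 ?posrE ?invr_gt0 // ?ltr_wpDr //.
rewrite (bigD1 i) //= addrCA lerDl addr_ge0 //.
by apply: sumr_ge0 => l _; rewrite invr_ge0 ltW.
Qed.

Lemma finite_upper_bound {R : realType} {I : finType} (f : I -> R) :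
  exists2 A : R, 0 <= A & forall i, f i <= A.
Proof.
exists (\sum_i `|f i|) => [|i]; first exact: sumr_ge0.
rewrite (bigD1 i) //= (le_trans (ler_norm _)) // lerDl; exact: sumr_ge0.
Qed.

Lemma has_grad_dotv {R : realType} {n : nat} (g w a : 'rV[R]_n) :
  has_grad (fun u => dotv g (u - w)) a g.
Proof.
move=> e e0; apply/nbhs_enormP; exists 1 => // u _.
have -> : dotv g (u - w) - dotv g (a - w) - dotv g (u - a) = 0.
  by rewrite !dotvBr; ring.
by rewrite normr0 mulr_ge0 ?enorm_ge0 // ltW.
Qed.

(** With the first two blocks frozen, only the last block of a displacement acts, and its norm is at
    most that of the displacement. *)
Lemma has_grad_join3_z {R : realType} {m n r : nat}
    (f : 'rV[R]_(m + n + r) -> R) a b (u : 'rV[R]_(m + n + r)) g :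
  has_grad f (join3 a b (rsubmx u)) g ->
  has_grad (fun v => f (join3 a b (rsubmx v))) u (join3 0 0 (rsubmx g)).
Proof.
move=> df e e0; have /nbhs_enormP[d d0 dP] := df e e0.
apply/nbhs_enormP; exists d => // v vd.
have vE : join3 a b (rsubmx v) - join3 a b (rsubmx u) = join3 0 0 (rsubmx (v - u)).
  by rewrite join3B !subrr linearB.
have vle : enorm (join3 (0 : 'rV[R]_m) (0 : 'rV[R]_n) (rsubmx (v - u))) <=
    enorm (v - u).
  rewrite -[v - u in leRHS]join3K; apply: enorm_join3_mono => //.
    by rewrite enorm0 enorm_ge0.
  by rewrite enorm0 enorm_ge0.
have := dP (join3 a b (rsubmx v)); rewrite vE => /(_ (le_lt_trans vle vd)).
have -> : dotv g (join3 0 0 (rsubmx (v - u))) = dotv (join3 0 0 (rsubmx g)) (v - u).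
  by rewrite dotv_join3r !dotv0 (dotvC (join3 _ _ _)) dotv_join3r !dotv0 dotvC.
by move=> /le_trans; apply; rewrite ler_wpM2l // ltW.
Qed.

Section BlockGradient.
Context {R : realType} {P Q r : nat} {p : 'I_P -> nat} {q : 'I_Q -> nat}.
Variable F : 'rV[R]_(\sum_(i < P) p i) -> 'rV[R]_(\sum_(j < Q) q j) ->
  'rV[R]_r -> R.

(** Both sides represent the same directional derivatives, computed once in the block and once along
    its embedding in the joint space. *)
Lemma block_grad_x (M : R) i a b c :
  lipschitz_grad M (fun xi : 'rV[R]_(p i) => F (set_block a xi) b c) ->
  differentiable (joint F) (join3 a b c) ->
  block_grad (fun x' => F x' b c) i a =
  submxrow (lsubmx (lsubmx (grad (joint F) (join3 a b c)))) i.
Proof.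
move=> [df _] dF; apply: dotv_ext => v.
pose g (xi : 'rV[R]_(p i)) := join3 (set_block a xi) b c.
have gE (t : R) : g (t *: v + submxrow a i) =
    t *: join3 (set_block 0 v) 0 0 + g (submxrow a i).
  by rewrite /g join3_line set_block_line set_block_id !scaler0 !add0r.
have FgE : (fun xi : 'rV[R]_(p i) => F (set_block a xi) b c) = joint F \o g.
  by apply/funext => xi; rewrite /= joint_join3.
rewrite /block_grad dotv_grad // -deriveE // FgE (derive_comp_line _ gE).
rewrite /g set_block_id deriveE // -dotv_grad //.
by rewrite dotv_join3r !dotv0 !addr0 dotv_set_block0.
Qed.

Lemma block_grad_y (M : R) j a b c :
  lipschitz_grad M (fun mu : 'rV[R]_(q j) => F a (set_block b mu) c) ->
  differentiable (joint F) (join3 a b c) ->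
  block_grad (fun y' => F a y' c) j b =
  submxrow (rsubmx (lsubmx (grad (joint F) (join3 a b c)))) j.
Proof.
move=> [df _] dF; apply: dotv_ext => v.
pose g (mu : 'rV[R]_(q j)) := join3 a (set_block b mu) c.
have gE (t : R) : g (t *: v + submxrow b j) =
    t *: join3 0 (set_block 0 v) 0 + g (submxrow b j).
  by rewrite /g join3_line set_block_line set_block_id !scaler0 !add0r.
have FgE : (fun mu : 'rV[R]_(q j) => F a (set_block b mu) c) = joint F \o g.
  by apply/funext => mu; rewrite /= joint_join3.
rewrite /block_grad dotv_grad // -deriveE // FgE (derive_comp_line _ gE).
rewrite /g set_block_id deriveE // -dotv_grad //.
by rewrite dotv_join3r !dotv0 addr0 add0r dotv_set_block0.
Qed.

End BlockGradient.

(** * Closed sets, limits and auxiliary estimates *)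

Lemma nonexpansive_continuous {R : realType} {m n : nat}
    (g : 'rV[R]_m -> 'rV[R]_n) :
  (forall u v, enorm (g u - g v) <= enorm (u - v)) -> continuous g.
Proof.
move=> glip u; apply/(@cvgrPdist_lt R 'rV[R]_n _ (nbhs u)) => e e0.
apply/nbhs_enormP; exists e => // v uv.
by rewrite distrC (le_lt_trans (normr_le_enorm _)) // (le_lt_trans (glip _ _)).
Qed.

Lemma closed_prod3 {R : realType} {m n r : nat} (A : set 'rV[R]_m)
    (B : set 'rV[R]_n) (D : set 'rV[R]_r) :
  closed A -> closed B -> closed D -> closed (prod3 A B D).
Proof.
move=> clA clB clD.
have -> : prod3 A B D = ((lsubmx \o lsubmx) @^-1` A `&`
    (rsubmx \o lsubmx) @^-1` B) `&` rsubmx @^-1` D.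
  by apply/seteqP; split => u => [[]|[[]]].
apply: closedI; [apply: closedI|]; (apply: closed_comp => //);
  move=> u _; apply: nonexpansive_continuous => {}u v; rewrite /= -!linearB.
- exact: enorm_join3_x.
- exact: enorm_join3_y.
- exact: enorm_join3_z.
Qed.

Lemma closed_prod_blocks {R : realType} {P : nat} {p : 'I_P -> nat}
    (Xs : forall i, set 'rV[R]_(p i)) :
  (forall i, closed (Xs i)) -> closed (prod_blocks Xs).
Proof.
move=> clX.
have -> : prod_blocks Xs = \bigcap_i ((fun x => submxrow x i) @^-1` Xs i).
  by apply/seteqP; split => x Xx i; [move=> _|]; exact: Xx.
apply: closed_bigI => i _; apply: closed_comp => // u _.
apply: nonexpansive_continuous => {}u v; rewrite -submxrowB; exact: enorm_submxrow.
Qed.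

(** Puts the objective into the form [F] plus a single indicator used by the abstract descent
    results. *)
Lemma sum_indicators {R : realType} {m n r : nat} (A : set 'rV[R]_m)
    (B : set 'rV[R]_n) (D : set 'rV[R]_r)
    (F : 'rV[R]_m -> 'rV[R]_n -> 'rV[R]_r -> R) :
  joint (fun a b c => ((F a b c)%:E + ind R A a + ind R B b + ind R D c)%E) =
  (fun w => (joint F w)%:E + ind R (prod3 A B D) w)%E.
Proof.
apply/funext => w; rewrite {1}/joint /ind.
set a := lsubmx (lsubmx w); set b := rsubmx (lsubmx w); set c := rsubmx w.
have -> : (w \in prod3 A B D) = [&& a \in A, b \in B & c \in D].
  apply/idP/idP; first by move/set_mem=> [Aa Bb Dc]; rewrite !mem_set.
  by move=> /and3P[/set_mem ? /set_mem ? /set_mem ?]; apply/mem_set; split.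
by case: (a \in A); case: (b \in B); case: (c \in D); rewrite /= ?adde0.
Qed.

Lemma bounded_enorm {R : realType} {n : nat} (B : set 'rV[R]_n) :
  bounded_set B -> exists2 rho : R, 0 <= rho & forall u, B u -> enorm u <= rho.
Proof.
move=> [M [_ BM]]; exists (n.+1%:R * (`|M| + 1)) => [|u Bu]; first by rewrite mulr_ge0.
rewrite (le_trans (enorm_le_normr _)) // ler_pM2l //; apply: BM => //.
by rewrite (le_lt_trans (ler_norm _)) // ltrDl.
Qed.

Lemma cvg_dotv {R : realType} {n : nat} (a b : nat -> 'rV[R]_n) (a' b' : 'rV[R]_n) :
  a k @[k --> \oo] --> a' -> b k @[k --> \oo] --> b' ->
  dotv (a k) (b k) @[k --> \oo] --> dotv a' b'.
Proof.
move=> ca cb; apply: (cvg_big add_continuous) => i _; apply: cvgM.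
  exact: (cvg_comp _ (fun M : 'rV[R]_n => M ord0 i) ca (@coord_continuous _ _ _ _ _ a')).
exact: (cvg_comp _ (fun M : 'rV[R]_n => M ord0 i) cb (@coord_continuous _ _ _ _ _ b')).
Qed.

Lemma cvg_enorm {R : realType} {n : nat} (a : nat -> 'rV[R]_n) (b : 'rV[R]_n) :
  a k @[k --> \oo] --> b -> enorm (a k - b) @[k --> \oo] --> 0.
Proof.
move=> ca; rewrite -[X in _ --> X](enorm0 (n := n)) -(subrr b).
exact: (cvg_comp _ _ ca (@enorm_continuous _ _ b b)).
Qed.

Lemma enorm_squeeze {R : realType} {n : nat} (a : nat -> 'rV[R]_n) (b : 'rV[R]_n)
    (t : nat -> R) :
  (forall k, enorm (a k - b) <= t k) -> t k @[k --> \oo] --> 0 ->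
  a k @[k --> \oo] --> b.
Proof.
move=> at_le /cvgrPdist_lt ct; apply/cvgrPdist_lt => e /ct; apply: filterS => k.
rewrite sub0r normrN distrC => te; rewrite (le_lt_trans (normr_le_enorm _)) //.
by rewrite (le_lt_trans (at_le k)) // (le_lt_trans (ler_norm _)).
Qed.

(** Within distance e / (A + 1) the quadratic bound is at most e |w - u|, so a proximal normal is a
    Fréchet normal. *)
Lemma proximal_normal {R : realType} {n : nat} (D : set 'rV[R]_n) (A : R)
    (u v : 'rV[R]_n) :
  0 <= A -> D u -> (forall w, D w -> dotv v (w - u) <= A * enorm (w - u) ^+ 2) ->
  limiting_subdiff (ind R D) u v.
Proof.
move=> A0 Du uv; apply: limiting_subdiff_indicator => // e e0.
have A1 : 0 < A + 1 by rewrite ltr_wpDl.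
apply/nbhs_enormP; exists (e / (A + 1)) => [|w wu Dw]; first by rewrite divr_gt0.
apply: le_trans (uv w Dw) _; rewrite expr2 mulrA ler_wpM2r ?enorm_ge0 //.
by move: wu; rewrite ltr_pdivlMr //; have := enorm_ge0 (w - u); nra.
Qed.

Lemma nneseries_lt_pinfty {R : realType} (d : nat -> R) (S : R) :
  (forall k, 0 <= d k) -> (forall N, \sum_(k < N) d k <= S) ->
  (\sum_(1 <= k <oo) (d k)%:E < +oo)%E.
Proof.
move=> d0 dS; apply: le_lt_trans (ltry S).
apply: lime_le; first by apply: is_cvg_nneseries => k _ _; rewrite lee_fin.
apply: nearW => N; rewrite sumEFin lee_fin; apply: le_trans (dS N).
(* The series starts at 1, so the nonnegative term [d 0] is dropped. *)
case: N => [|N]; first by rewrite big_geq // big_ord0.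
by rewrite -(big_mkord xpredT d) [leRHS]big_ltn // lerDr.
Qed.

Lemma ereal_sup_range_le {R : realType} (L : nat -> R) (lam : R) k :
  (ereal_sup (range (fun k => (L k)%:E)) <= lam%:E)%E -> L k <= lam.
Proof.
move=> supL; rewrite -lee_fin; apply: le_trans supL.
by apply: ereal_sup_ubound; exists k.
Qed.

(** al max(L, eta) - L >= (al - 1) max(L, eta) >= (al - 1) eta: the threshold [eta] keeps the
    decrease uniformly positive, and [lam] keeps the coefficient bounded. *)
Lemma prox_coefficient {R : realType} (al L eta lam a A : R) : 0 < eta -> 1 < al -> L <= lam ->
  a <= (al - 1) * eta / 2 -> al * Num.max lam eta / 2 <= A ->
  2 * a + L <= al * Num.max L eta <= 2 * A.
Proof.
move=> eta0 al1 Ll aP AP.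
have h1 : L <= Num.max L eta by rewrite le_max lexx.
have h2 : eta <= Num.max L eta by rewrite le_max lexx orbT.
have h3 : Num.max L eta <= Num.max lam eta.
  by rewrite ge_max !le_max Ll lexx orbT.
have h4 : (al - 1) * eta <= (al - 1) * Num.max L eta by rewrite ler_wpM2l //; lra.
have h5 : al * Num.max L eta <= al * Num.max lam eta by rewrite ler_wpM2l //; lra.
by apply/andP; split; lra.
Qed.

(** * Estimates for the iterates and the limit point *)

Section Algorithm.
Context {R : realType} {P Q r : nat} {p : 'I_P -> nat} {q : 'I_Q -> nat}.
Variables (Xs : forall i : 'I_P, set 'rV[R]_(p i))
  (Ys : forall j : 'I_Q, set 'rV[R]_(q j)) (Z : set 'rV[R]_r).
Variable F : 'rV[R]_(\sum_(i < P) p i) -> 'rV[R]_(\sum_(j < Q) q j) ->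
  'rV[R]_r -> R.
Variables (Lx : forall i : 'I_P, 'rV[R]_(\sum_(l < P.-1) p (lift i l)) ->
    'rV[R]_(\sum_(j < Q) q j) -> 'rV[R]_r -> R)
  (Ly : forall j : 'I_Q, 'rV[R]_(\sum_(i < P) p i) ->
    'rV[R]_(\sum_(l < Q.-1) q (lift j l)) -> 'rV[R]_r -> R).
Arguments Lx : clear implicits.
Arguments Ly : clear implicits.
Variables (etax alpha : 'I_P -> R) (etay beta : 'I_Q -> R) (gamma : R).
Variables (x : nat -> 'rV[R]_(\sum_(i < P) p i))
  (y : nat -> 'rV[R]_(\sum_(j < Q) q j)) (z : nat -> 'rV[R]_r).
Hypotheses (hetax : forall i, 0 < etax i) (hetay : forall j, 0 < etay j)
  (halpha : forall i, 1 < alpha i) (hbeta : forall j, 1 < beta j)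
  (hgamma : 0 < gamma).
Hypothesis hseq : implicit_explicit_sequence Xs Ys Z F Lx Ly
  etax alpha etay beta gamma x y z.
Local Notation C := (prod3 (prod_blocks Xs) (prod_blocks Ys) Z).
Hypothesis hFdiff : forall w, C w -> differentiable (joint F) w.
Hypothesis hLx : forall i x' y' z',
  prod_blocks Xs x' -> prod_blocks Ys y' -> Z z' ->
  lipschitz_grad (Lx i (other_blocks x' i) y' z')
    (fun xi : 'rV[R]_(p i) => F (set_block x' xi) y' z').
Hypothesis hLy : forall j x' y' z',
  prod_blocks Xs x' -> prod_blocks Ys y' -> Z z' ->
  lipschitz_grad (Ly j x' (other_blocks y' j) z')
    (fun mu : 'rV[R]_(q j) => F x' (set_block y' mu) z').
Hypothesis hgradLip : forall B, bounded_set B -> B `<=` C ->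
  exists M : R, forall w w', B w -> B w' ->
    enorm (grad (joint F) w - grad (joint F) w') <= M * enorm (w - w').
Hypothesis hlambda : exists (lambdax : 'I_P -> R) (lambday : 'I_Q -> R),
  (forall i, 0 < lambdax i /\
     (ereal_sup (range (fun k => (Lx i (others x k i) (y k) (z k))%:E))
        <= (lambdax i)%:E)%E) /\
  (forall j, 0 < lambday j /\
     (ereal_sup (range (fun k => (Ly j (x k.+1) (others y k j) (z k))%:E))
        <= (lambday j)%:E)%E).
Hypothesis hbounded : bounded_set (range (fun k => join3 (x k) (y k) (z k))).

Let w k := join3 (x k) (y k) (z k).
Let d k := enorm (w k.+1 - w k).
Let Gx k := \mxrow_i block_grad (fun x' => F x' (y k) (z k)) i (sweep x k i).
Let Gy k := \mxrow_j block_grad (fun y' => F (x k.+1) y' (z k)) j (sweep y k j).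

(* What step [k] minimises, up to a quadratic term: [F - F (w k)] linearised in
   the [x]- and [y]-blocks at the points of the sweep, and exact in [z]. *)
Definition model k (u : 'rV[R]_(\sum_(i < P) p i + \sum_(j < Q) q j + r)) :=
  dotv (join3 (Gx k) (Gy k) 0) (u - w k) +
  (joint F (join3 (x k.+1) (y k.+1) (rsubmx u)) +
   - F (x k.+1) (y k.+1) (z k)).

Definition model_grad k (u : 'rV[R]_(\sum_(i < P) p i + \sum_(j < Q) q j + r)) :=
  join3 (Gx k) (Gy k) 0 +
  join3 0 0 (rsubmx (grad (joint F) (join3 (x k.+1) (y k.+1) (rsubmx u)))).

Lemma iterates_feasible k :
  [/\ prod_blocks Xs (x k), prod_blocks Ys (y k) & Z (z k)].
Proof.
have [X0 Y0 Z0 step] := hseq; case: k => [//|k]; have [stepx stepy [Zk _]] := step k.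
by split=> // i; [have [] := stepx i|have [] := stepy i].
Qed.

Lemma iterates_C k : C (w k).
Proof.
by have [? ? ?] := iterates_feasible k; rewrite /prod3 /= joint_join3.
Qed.

Lemma model_iterate k : model k (w k) = 0.
Proof.
by rewrite /model subrr dotv0 add0r joint_join3 /w join3_z subrr.
Qed.

Lemma model_has_grad k u : C u -> has_grad (model k) u (model_grad k u).
Proof.
move=> [_ _ Zu]; apply: has_gradD; first exact: has_grad_dotv.
apply: has_gradDcst; apply: has_grad_join3_z; apply: differentiable_has_grad.
have [? ? _] := iterates_feasible k.+1.
by apply: hFdiff; rewrite /prod3 /= joint_join3.
Qed.

(** The x-sweep ends at the value where the y-sweep starts, and the latter ends at F(x_{k+1},
    y_{k+1}, z_k), the value subtracted in [model]; adding minimality in z closes the chain. *)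
Lemma model_decrease_bound : exists2 a : R, 0 < a & exists2 A : R, 0 <= A &
  forall k u, C u -> joint F (w k.+1) + a * d k ^+ 2 <=
    joint F (w k) + model k u + A * enorm (u - w k) ^+ 2.
Proof.
have [lx [ly [hlx hly]]] := hlambda.
have [i|ax ax0 axP] := @finite_lower_bound R _ (fun i => (alpha i - 1) * etax i / 2).
  by rewrite divr_gt0 // mulr_gt0 // subr_gt0.
have [j|ay ay0 ayP] := @finite_lower_bound R _ (fun j => (beta j - 1) * etay j / 2).
  by rewrite divr_gt0 // mulr_gt0 // subr_gt0.
have [Ax Ax0 AxP] := finite_upper_bound (fun i => alpha i * Num.max (lx i) (etax i) / 2).
have [Ay Ay0 AyP] := finite_upper_bound (fun j => beta j * Num.max (ly j) (etay j) / 2).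
have g0 : 0 < gamma / 2 by rewrite divr_gt0.
pose a := Num.min (Num.min ax ay) (gamma / 2).
have aax : a <= ax by rewrite !ge_min lexx.
have aay : a <= ay by rewrite !ge_min lexx orbT.
have ag : a <= gamma / 2 by rewrite !ge_min lexx !orbT.
exists a; first by rewrite !lt_min ax0 ay0.
exists (Ax + Ay + gamma / 2); first by rewrite !addr_ge0 // ltW.
set A := Ax + Ay + gamma / 2 => k u [Xu Yu Zu].
have [_ _ _ step] := hseq; have [stepx stepy [_ stepz]] := step k.
have [Xk Yk Zk] := iterates_feasible k; have [Xk1 Yk1 _] := iterates_feasible k.+1.
have Xx l : prod_blocks Xs (x l) by have [] := iterates_feasible l.
have Yy l : prod_blocks Ys (y l) by have [] := iterates_feasible l.
have AxA : Ax <= A by rewrite /A; lra.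
have AyA : Ay <= A by rewrite /A; lra.
have decx := sweep_decrease (fun i => hLx i (prod_blocks_sweep k i Xx) Yk Zk) stepx
  (fun i => prox_coefficient (hetax i) (halpha i) (ereal_sup_range_le k (hlx i).2)
     (le_trans aax (axP i)) (le_trans (AxP i) AxA)) Xu.
have decy := sweep_decrease (fun j => hLy j Xk1 (prod_blocks_sweep k j Yy) Zk) stepy
  (fun j => prox_coefficient (hetay j) (hbeta j) (ereal_sup_range_le k (hly j).2)
     (le_trans aay (ayP j)) (le_trans (AyP j) AyA)) Yu.
have decz := stepz _ Zu.
rewrite -/(Gx k) in decx; rewrite -/(Gy k) in decy.
have dE : d k ^+ 2 = enorm (x k.+1 - x k) ^+ 2 + enorm (y k.+1 - y k) ^+ 2 +
    enorm (z k.+1 - z k) ^+ 2.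
  by rewrite /d /w join3B enorm_join3_sqr.
have uE : u - w k = join3 (lsubmx (lsubmx u) - x k) (rsubmx (lsubmx u) - y k)
    (rsubmx u - z k).
  by rewrite -join3B join3K.
rewrite dE /model uE enorm_join3_sqr dotv_join3 dot0v addr0 !joint_join3.
have := sqr_ge0 (enorm (z k.+1 - z k)); have := sqr_ge0 (enorm (rsubmx u - z k)).
have Ag : gamma / 2 <= A by rewrite /A; lra.
move=> h1 h2.
have h3 := ler_wpM2r h1 Ag; have h4 := ler_wpM2r h2 ag.
lra.
Qed.

(** Every block of [model_grad] is a block of the gradient of [joint F] at a feasible point [v] with
    |v - w_k| <= d_k + |u - w_k|, to which the Lipschitz bound on bounded sets applies. *)
Lemma model_grad_bound (B : set 'rV[R]_(\sum_(i < P) p i + \sum_(j < Q) q j + r)) :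
  bounded_set B -> B `<=` C -> exists M, forall k u, B u ->
    enorm (model_grad k u - grad (joint F) u) <= M * (d k + enorm (u - w k)).
Proof.
move=> bB BC.
have [rB rB0 BrB] := bounded_enorm bB; have [rw rw0 wrw] := bounded_enorm hbounded.
(* [rho] bounds [B] and all iterates, so |v| <= d_k + |u - w_k| + |w_k| <= 5 rho. *)
pose rho := rB + rw.
have Bn u : B u -> enorm u <= rho by move=> /BrB; rewrite /rho; lra.
have wn k : enorm (w k) <= rho.
  by have := wrw (w k) (ex_intro2 _ _ k I erefl); rewrite /rho; lra.
have [|u [] //|M0 lip] := hgradLip (B := C `&` [set u | enorm (u - 0) <= 5 * rho]).
  exact: bounded_enorm_ball.
have key k u v : B u -> C v -> enorm (v - w k) <= d k + enorm (u - w k) ->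
    enorm (grad (joint F) v - grad (joint F) u) <=
    `|M0| * 2 * (d k + enorm (u - w k)).
  move=> Bu Cv vw.
  have dn : d k <= 2 * rho.
    by have := ler_enormD (w k.+1) (- w k); rewrite enormN -/(d k);
      have := wn k; have := wn k.+1; lra.
  have un : enorm (u - w k) <= 2 * rho.
    by have := ler_enormD u (- w k); rewrite enormN;
      have := wn k; have := Bn _ Bu; lra.
  have vn : enorm v <= 5 * rho.
    by have := ler_enormD (v - w k) (w k); rewrite subrK; have := wn k; lra.
  have Bu' : (C `&` [set u | enorm (u - 0) <= 5 * rho]) u.
    split; first exact: BC.
    by rewrite /= subr0; have := Bn _ Bu; have := enorm_ge0 u; lra.
  have Bv' : (C `&` [set u | enorm (u - 0) <= 5 * rho]) v.
    by split=> //; rewrite /= subr0.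
  apply: (le_trans (lip _ _ Bv' Bu')).
  apply: (@le_trans _ _ (`|M0| * enorm (v - u))).
    by rewrite ler_wpM2r ?enorm_ge0 // ler_norm.
  rewrite -mulrA ler_wpM2l //.
  have := ler_enorm_dist (w k) v u; rewrite (enormB (w k)).
  have := enorm_ge0 (w k.+1 - w k); rewrite -/(d k); lra.
(* One use of [key] for each of the [P] blocks of x and the [Q] blocks of y, and one for z. *)
exists ((P + Q + 1)%:R * (`|M0| * 2)) => k u Bu.
set K := `|M0| * 2 * (d k + enorm (u - w k)).
have -> : (P + Q + 1)%:R * (`|M0| * 2) * (d k + enorm (u - w k)) =
    P%:R * K + Q%:R * K + K.
  by rewrite /K !natrD; ring.
have [Xk Yk Zk] := iterates_feasible k; have [Xk1 Yk1 _] := iterates_feasible k.+1.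
have Xx l : prod_blocks Xs (x l) by have [] := iterates_feasible l.
have Yy l : prod_blocks Ys (y l) by have [] := iterates_feasible l.
have [_ _ Zu] := BC _ Bu.
have dE : d k = enorm (join3 (x k.+1 - x k) (y k.+1 - y k) (z k.+1 - z k)).
  by rewrite /d /w join3B.
have u0 := enorm_ge0 (u - w k).
set g := grad (joint F) u.
have -> : model_grad k u - g = join3 (Gx k - lsubmx (lsubmx g))
    (Gy k - rsubmx (lsubmx g))
    (rsubmx (grad (joint F) (join3 (x k.+1) (y k.+1) (rsubmx u)) - g)).
  rewrite -[g in LHS]join3K /model_grad -(scale1r (join3 (Gx k) _ _)) join3_line.
  by rewrite !scale1r !addr0 add0r join3B linearB.
apply: le_trans (enorm_join3_le _ _ _) _; apply: lerD; first apply: lerD.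
- apply: le_trans (enorm_le_blocks _) _.
  rewrite mulr_natl -[X in K *+ X]card_ord -sumr_const; apply: ler_sum => i _.
  have Xs' := prod_blocks_sweep k i Xx.
  have Ci : C (join3 (sweep x k i) (y k) (z k)) by rewrite /prod3 /= joint_join3.
  rewrite submxrowB mxrowK (block_grad_x (hLx i Xs' Yk Zk) (hFdiff Ci)).
  rewrite -submxrowB -!linearB; apply: le_trans (enorm_submxrow _ _) _.
  apply: le_trans (enorm_join3_x _) _; apply: key => //.
  apply: (@le_trans _ _ (d k)); last by rewrite lerDl.
  rewrite dE join3B !subrr; apply: enorm_join3_mono; rewrite ?enorm0 ?enorm_ge0 //.
  exact: enorm_sweep.
- apply: le_trans (enorm_le_blocks _) _.
  rewrite mulr_natl -[X in K *+ X]card_ord -sumr_const; apply: ler_sum => j _.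
  have Ys' := prod_blocks_sweep k j Yy.
  have Cj : C (join3 (x k.+1) (sweep y k j) (z k)) by rewrite /prod3 /= joint_join3.
  rewrite submxrowB mxrowK (block_grad_y (hLy j Xk1 Ys' Zk) (hFdiff Cj)).
  rewrite -submxrowB -!linearB; apply: le_trans (enorm_submxrow _ _) _.
  apply: le_trans (enorm_join3_y _) _; apply: key => //.
  apply: (@le_trans _ _ (d k)); last by rewrite lerDl.
  rewrite dE join3B !subrr; apply: enorm_join3_mono; rewrite ?enorm0 ?enorm_ge0 //.
  exact: enorm_sweep.
- apply: le_trans (enorm_join3_z _) _; apply: key => //.
    by rewrite /prod3 /= joint_join3.
  (* The point takes x and y from the next iterate and z from [u], so its displacement is a part of
     the step plus a part of [u - w k]. *)
  have -> : join3 (x k.+1) (y k.+1) (rsubmx u) - w k =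
      join3 (x k.+1 - x k) (y k.+1 - y k) 0 + join3 0 0 (rsubmx (u - w k)).
    rewrite -(scale1r (join3 (x k.+1 - x k) _ _)) join3_line !scale1r !addr0 add0r.
    by rewrite join3B linearB /w /= join3_z.
  apply: le_trans (ler_enormD _ _) _; rewrite dE; apply: lerD.
    by apply: enorm_join3_mono => //; rewrite enorm0 enorm_ge0.
  rewrite -[u - w k in leRHS]join3K.
  by apply: enorm_join3_mono; rewrite ?enorm0 ?enorm_ge0.
Qed.

(** Passes to the limit in the descent inequality at a fixed [u]: the values F(w_{k+1}) - F(w_k)
    tend to 0 and the linear parts of the models to that of [grad (joint F) ws]. *)
Lemma limit_minimal (A : R) (ws : 'rV[R]_(\sum_(i < P) p i + \sum_(j < Q) q j + r)) :
  (exists2 a, 0 < a & forall k u, C u -> joint F (w k.+1) + a * d k ^+ 2 <=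
    joint F (w k) + model k u + A * enorm (u - w k) ^+ 2) ->
  C ws -> w k @[k --> \oo] --> ws -> forall u, C u ->
  0 <= dotv (grad (joint F) ws)
      (join3 (lsubmx (lsubmx (u - ws))) (rsubmx (lsubmx (u - ws))) 0) +
    (joint F (join3 (lsubmx (lsubmx ws)) (rsubmx (lsubmx ws)) (rsubmx u)) -
     joint F ws) + A * enorm (u - ws) ^+ 2.
Proof.
move=> [a a0 hA] Cws cw u Cu; set gs := grad (joint F) ws.
have cwS : w k.+1 @[k --> \oo] --> ws by rewrite -(cvg_shiftS w) in cw.
have cF v : C v -> {for v, continuous (joint F)}.
  by move=> Cv; exact: differentiable_continuous (hFdiff Cv).
have cd : d k @[k --> \oo] --> 0.
  apply: (squeeze_cvgr (f := fun=> 0)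
    (h := fun k => enorm (w k.+1 - ws) + enorm (w k - ws))).
  - apply: nearW => k; rewrite enorm_ge0 /=.
    by rewrite (enormB (w k)); exact: ler_enorm_dist.
  - exact: cvg_cst.
  - by rewrite -[X in _ --> X](addr0 0); apply: cvgD; exact: cvg_enorm.
have cFw : joint F (w k) @[k --> \oo] --> joint F ws := cvg_comp _ _ cw (cF _ Cws).
have cFwS : joint F (w k.+1) @[k --> \oo] --> joint F ws :=
  cvg_comp _ _ cwS (cF _ Cws).
have cwz : join3 (x k.+1) (y k.+1) (z k) @[k --> \oo] --> ws.
  apply: (@enorm_squeeze _ _ _ _ (fun k => d k + enorm (w k - ws))).
    move=> k; apply: le_trans (ler_enorm_dist (w k) _ _) _; rewrite lerD2r.
    rewrite /d /w !join3B subrr; apply: enorm_join3_mono => //.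
    by rewrite enorm0 enorm_ge0.
  by rewrite -[X in _ --> X](addr0 0); apply: cvgD => //; exact: cvg_enorm.
have cFwz : F (x k.+1) (y k.+1) (z k) @[k --> \oo] --> joint F ws.
  under eq_fun do rewrite -joint_join3.
  exact: cvg_comp _ _ cwz (cF _ Cws).
pose us := join3 (lsubmx (lsubmx ws)) (rsubmx (lsubmx ws)) (rsubmx u).
have Cus : C us.
  by have [Xws Yws _] := Cws; have [_ _ Zu] := Cu; rewrite /prod3 /= joint_join3.
have cwu : join3 (x k.+1) (y k.+1) (rsubmx u) @[k --> \oo] --> us.
  apply: (@enorm_squeeze _ _ _ _ (fun k => enorm (w k.+1 - ws))); last exact: cvg_enorm.
  move=> k; rewrite -[ws in leRHS]join3K !join3B subrr; apply: enorm_join3_mono => //.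
  by rewrite enorm0 enorm_ge0.
have cFwu : joint F (join3 (x k.+1) (y k.+1) (rsubmx u)) @[k --> \oo] --> joint F us.
  exact: cvg_comp _ _ cwu (cF _ Cus).
(* The gradient bound on the singleton of [ws] gives convergence of the model gradients there. *)
have [||M MP] := @model_grad_bound [set ws].
- by exists `|ws|; split; [exact: num_real|move=> b hb _ ->; exact: ltW].
- by move=> _ ->.
have cg : model_grad k ws @[k --> \oo] --> gs.
  apply: (@enorm_squeeze _ _ _ _ (fun k => M * (d k + enorm (w k - ws)))).
    by move=> k; rewrite (enormB (w k)); exact: MP.
  rewrite -[X in _ --> X](mulr0 M); apply: cvgMl_tmp.
  by rewrite -[X in _ --> X](addr0 0); apply: cvgD => //; exact: cvg_enorm.
(* The z-component is dropped because the model is exact, not linearised, in z. *)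
pose h v : 'rV[R]_(\sum_(i < P) p i + \sum_(j < Q) q j + r) :=
  join3 (lsubmx (lsubmx (u - v))) (rsubmx (lsubmx (u - v))) 0.
have ch : h (w k) @[k --> \oo] --> h ws.
  apply: (@enorm_squeeze _ _ _ _ (fun k => enorm (w k - ws))); last exact: cvg_enorm.
  move=> k; have uvE : u - w k - (u - ws) = ws - w k.
    by rewrite opprB addrC addrA subrK.
  rewrite /h join3B -!linearB uvE subrr.
  rewrite (enormB (w k)) -[ws - w k in leRHS]join3K; apply: enorm_join3_mono => //.
  by rewrite enorm0 enorm_ge0.
have cu : enorm (u - w k) ^+ 2 @[k --> \oo] --> enorm (u - ws) ^+ 2.
  have cn : enorm (u - w k) @[k --> \oo] --> enorm (u - ws).
    under eq_fun do rewrite enormB.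
    rewrite (enormB u); exact: (cvg_comp _ _ cw (@enorm_continuous _ _ u ws)).
  exact: (cvgM cn cn).
have lhs : joint F (w k.+1) - joint F (w k) @[k --> \oo] --> (0 : R).
  by rewrite -(subrr (joint F ws)); exact: cvgB.
have rhs : dotv (model_grad k ws) (h (w k)) +
    (joint F (join3 (x k.+1) (y k.+1) (rsubmx u)) - F (x k.+1) (y k.+1) (z k)) +
    A * enorm (u - w k) ^+ 2 @[k --> \oo] -->
    dotv gs (h ws) + (joint F us - joint F ws) + A * enorm (u - ws) ^+ 2.
  apply: cvgD; first (apply: cvgD; [exact: cvg_dotv|exact: cvgB]).
  exact: cvgMl_tmp.
apply: ler_cvg_to lhs rhs _; apply: nearW => k.
have := hA k _ Cu; rewrite /model /=.
have -> : dotv (model_grad k ws) (h (w k)) = dotv (join3 (Gx k) (Gy k) 0) (u - w k).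
  rewrite /model_grad dotvDl [X in _ + X]dotv_join3 !dot0v dotv0 !addr0.
  by rewrite -[u - w k in RHS]join3K !dotv_join3 dotv0 dot0v.
have := sqr_ge0 (d k); nra.
Qed.

(** Minimality at the limit is tested at points differing from [ws] in one block. The x- and
    y-blocks give proximal normals; in z the exact difference of [F] is first expanded at [ws]. *)
Lemma limit_normals (A : R) (ws : 'rV[R]_(\sum_(i < P) p i + \sum_(j < Q) q j + r)) :
  0 <= A ->
  (exists2 a, 0 < a & forall k u, C u -> joint F (w k.+1) + a * d k ^+ 2 <=
    joint F (w k) + model k u + A * enorm (u - w k) ^+ 2) ->
  C ws -> w k @[k --> \oo] --> ws ->
  prod3 (limiting_subdiff (ind R (prod_blocks Xs)) (lsubmx (lsubmx ws)))
        (limiting_subdiff (ind R (prod_blocks Ys)) (rsubmx (lsubmx ws)))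
        (limiting_subdiff (ind R Z) (rsubmx ws)) (- grad (joint F) ws).
Proof.
move=> A0 hA Cws cw; have [Xws Yws Zws] := Cws.
have min := limit_minimal hA Cws cw; set gs := grad (joint F) ws in min *.
set a := lsubmx (lsubmx ws) in Xws min *; set b := rsubmx (lsubmx ws) in Yws min *.
set c := rsubmx ws in Zws min *.
have wsE : join3 a b c = ws by exact: join3K.
split; rewrite ?linearN.
- apply: (proximal_normal A0) => // u Xu; have Cu : C (join3 u b c).
    by rewrite /prod3 /= joint_join3.
  have := min _ Cu; rewrite join3_z wsE subrr addr0 -{1 2 3}wsE join3B !subrr.
  rewrite join3_x join3_y enorm_join3_sqr !enorm0 !expr0n !addr0 dotv_join3r.
  by rewrite !dotv0 !addr0 dotvNl; lra.
- apply: (proximal_normal A0) => // u Yu; have Cu : C (join3 a u c).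
    by rewrite /prod3 /= joint_join3.
  have := min _ Cu; rewrite join3_z wsE subrr addr0 -{1 2 3}wsE join3B !subrr.
  rewrite join3_x join3_y enorm_join3_sqr !enorm0 !expr0n !addr0 add0r dotv_join3r.
  by rewrite !dotv0 addr0 add0r dotvNl; lra.
- apply: limiting_subdiff_indicator => // e e0.
  (* Half of [e] pays for the first-order remainder of [F], half for the quadratic term. *)
  have e2 : 0 < e / 2 by rewrite divr_gt0.
  have A1 : 0 < A + 1 by rewrite ltr_wpDl.
  have /nbhs_enormP[t t0 tP] := differentiable_has_grad (hFdiff Cws) e2.
  apply/nbhs_enormP; exists (Num.min t (e / 2 / (A + 1))) => [|u].
    by rewrite lt_min t0 divr_gt0.
  rewrite lt_min => /andP[ut ue] Zu; have Cu : C (join3 a b u).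
    by rewrite /prod3 /= joint_join3.
  have uE : join3 a b u - ws = join3 0 0 (u - c) by rewrite -wsE join3B !subrr.
  have nE : enorm (join3 (0 : 'rV[R]_(\sum_(i < P) p i))
      (0 : 'rV[R]_(\sum_(j < Q) q j)) (u - c)) = enorm (u - c).
    by rewrite /enorm dotv_join3 !dot0v !add0r.
  have := tP (join3 a b u); rewrite uE nE => /(_ ut).
  have := min _ Cu; rewrite join3_z uE join3_x join3_y nE -/gs.
  rewrite !dotv_join3r !dotv0 !add0r dotvNl ler_norml => h1 /andP[_ h2].
  have : A * enorm (u - c) ^+ 2 <= e / 2 * enorm (u - c).
    rewrite expr2 mulrA ler_wpM2r ?enorm_ge0 //.
    by move: ue; rewrite ltr_pdivlMr //; have := enorm_ge0 (u - c); nra.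
  by lra.
Qed.

End Algorithm.

Theorem theorem3p8 (R : realType) (P Q r : nat)
    (p : 'I_P -> nat) (q : 'I_Q -> nat)
    (Xs : forall i : 'I_P, set 'rV[R]_(p i))
    (Ys : forall j : 'I_Q, set 'rV[R]_(q j))
    (Z : set 'rV[R]_r)
    (F : 'rV[R]_(\sum_(i < P) p i) -> 'rV[R]_(\sum_(j < Q) q j) ->
         'rV[R]_r -> R)
    (Lx : forall i : 'I_P, 'rV[R]_(\sum_(l < P.-1) p (lift i l)) ->
          'rV[R]_(\sum_(j < Q) q j) -> 'rV[R]_r -> R)
    (Ly : forall j : 'I_Q, 'rV[R]_(\sum_(i < P) p i) ->
          'rV[R]_(\sum_(l < Q.-1) q (lift j l)) -> 'rV[R]_r -> R)
    (etax alpha : 'I_P -> R) (etay beta : 'I_Q -> R) (gamma : R)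
    (x : nat -> 'rV[R]_(\sum_(i < P) p i))
    (y : nat -> 'rV[R]_(\sum_(j < Q) q j))
    (z : nat -> 'rV[R]_r)
    (* parameters of the algorithm *)
    (hetax : forall i, 0 < etax i) (hetay : forall j, 0 < etay j)
    (halpha : forall i, 1 < alpha i) (hbeta : forall j, 1 < beta j)
    (hgamma : 0 < gamma)
    (hseq : implicit_explicit_sequence Xs Ys Z F Lx Ly
              etax alpha etay beta gamma x y z)
    (* (i) *)
    (hp : forall i, (0 < p i)%N) (hq : forall j, (0 < q j)%N) (hr : (0 < r)%N)
    (hX : forall i, Xs i !=set0 /\ closed (Xs i))
    (hY : forall j, Ys j !=set0 /\ closed (Ys j))
    (hZ : Z !=set0 /\ closed Z)
    (* (ii) *)
    (hFdiff : forall w, prod3 (prod_blocks Xs) (prod_blocks Ys) Z w ->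
       differentiable (joint F) w)
    (hFinf : (-oo < ereal_inf (range (fun w => (joint F w)%:E)))%E)
    (hLx : forall i x' y' z',
       prod_blocks Xs x' -> prod_blocks Ys y' -> Z z' ->
       lipschitz_grad (Lx i (other_blocks x' i) y' z')
         (fun xi : 'rV[R]_(p i) => F (set_block x' xi) y' z'))
    (hLy : forall j x' y' z',
       prod_blocks Xs x' -> prod_blocks Ys y' -> Z z' ->
       lipschitz_grad (Ly j x' (other_blocks y' j) z')
         (fun mu : 'rV[R]_(q j) => F x' (set_block y' mu) z'))
    (* (iii) *)
    (hgradLip : forall B, bounded_set B ->
       B `<=` prod3 (prod_blocks Xs) (prod_blocks Ys) Z ->
       exists M : R, forall w w', B w -> B w' ->
         enorm (grad (joint F) w - grad (joint F) w') <= M * enorm (w - w'))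
    (hlambda : exists (lambdax : 'I_P -> R) (lambday : 'I_Q -> R),
       (forall i, 0 < lambdax i /\
          (ereal_sup (range (fun k => (Lx i (others x k i) (y k) (z k))%:E))
             <= (lambdax i)%:E)%E) /\
       (forall j, 0 < lambday j /\
          (ereal_sup (range (fun k => (Ly j (x k.+1) (others y k j) (z k))%:E))
             <= (lambday j)%:E)%E))
    (* (iv) *)
    (hbounded : bounded_set (range (fun k => join3 (x k) (y k) (z k))))
    (* (v) *)
    (hKL : KL_function (joint (fun x' y' z' =>
       ((F x' y' z')%:E + ind R (prod_blocks Xs) x' +
        ind R (prod_blocks Ys) y' + ind R Z z')%E))) :
  (\sum_(1 <= k <oo)
     (enorm (join3 (x k.+1) (y k.+1) (z k.+1) -
             join3 (x k) (y k) (z k)))%:E < +oo)%E /\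
  exists xs ys zs,
    join3 (x k) (y k) (z k) @[k --> \oo] --> join3 xs ys zs /\
    [set grad (joint F) (join3 xs ys zs) + v | v in
       prod3 (limiting_subdiff (ind R (prod_blocks Xs)) xs)
             (limiting_subdiff (ind R (prod_blocks Ys)) ys)
             (limiting_subdiff (ind R Z) zs)] 0.
Proof.
have clC : closed (prod3 (prod_blocks Xs) (prod_blocks Ys) Z).
  by apply: closed_prod3; [apply: closed_prod_blocks => i; have [] := hX i
    |apply: closed_prod_blocks => j; have [] := hY j|have [] := hZ].
have [a a0 [A A0 dec]] := model_decrease_bound hetax hetay halpha hbeta hgamma hseq
  hLx hLy hlambda.
rewrite sum_indicators in hKL.
(* The abstract descent result, for the joint iterates and [model]. *)
have [ws [Cws cw [S dS]]] := model_converges a0 A0 clC hFdiff (iterates_C hseq)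
  (model_iterate F x y z) (model_has_grad hseq hFdiff)
  (model_grad_bound hseq hFdiff hLx hLy hgradLip hbounded) dec hbounded hKL.
split; first by apply: nneseries_lt_pinfty dS => k; exact: enorm_ge0.
exists (lsubmx (lsubmx ws)), (rsubmx (lsubmx ws)), (rsubmx ws); rewrite join3K.
(* The normal vector is the negative gradient at the limit. *)
split=> //; exists (- grad (joint F) ws); last exact: subrr.
exact: (limit_normals hseq hFdiff hLx hLy hgradLip hbounded A0
  (ex_intro2 _ _ a a0 dec) Cws cw).
Qed.
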